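(* Let $\{\lambda_n\}$ be any strictly increasing sequence of stopping times and $\{h_n(X_0,\ldots,X_{\lambda_n})\}$ any sequence of estimators, such that for all binary classical renewal processes $\lim_{n\to\infty}\frac{\lambda_n}{n}=1$ almost surely. Then there exists a binary classical renewal process $\{X_n\}$ such that $$P\Bigl(\limsup_{n\to\infty}\bigl|h_n(X_0,\ldots,X_{\lambda_n})-\theta_{\lambda_n}\bigr|>0\Bigr)>0.$$
   Context: **Binary (classical) renewal process.** Let $\{p_k\}_{k=0}^\infty$ be a probability distribution on $\{0,1,2,\ldots\}$ with $\mu=\sum_{k}kp_k<\infty$. Consider the Markov chain $\{M_n\}$ on $\{0,1,2,\ldots\}$ with transition probabilities $p_{i,i-1}=1$ for $i\ge1$ and $p_{0,i}=p_i$ for $i\ge 0$, started from its unique stationary distribution (which gives mass $1/(1+\mu)$ to state $0$). The binary renewal process is $X_n=0$ if $M_n=0$ and $X_n=1$ otherwise. It is stationary; $p_k$ is the conditional probability that a run of exactly $k$ ones follows a given zero. **Stopping times and estimators** are universal: they are fixed functions of the observed binary sequence, chosen without knowledge of the process distribution. That is, each $\lambda_n$ is a function of the sequence $(x_0,x_1,\ldots)\in\{0,1\}^{\mathbb N}$ with values in $\{0,1,2,\ldots\}\cup\{\infty\}$ such that whether $\lambda_n=k$ depends only on $x_0,\ldots,x_k$, and each $h_n$ is a real-valued function of the finite binary string $(x_0,\ldots,x_{\lambda_n})$. The same $\lambda_n$, $h_n$ are applied to every binary renewal process. **Target.** $\theta_n=E\bigl(\max\{k\ge0: X_i=1\text{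 for all } n<i\le n+k\}\mid X_0,\ldots,X_n\bigr)$. If at least one zero occurs among $X_0,\ldots,X_n$, and $\tau$ denotes the $t\ge 0$ with $X_{n-t}=0$ and $X_i=1$ for $n-t<i\le n$, then $\theta_n=\dfrac{\sum_{k=0}^\infty k\,p_{k+\tau}}{\sum_{k=\tau}^\infty p_k}$ (if no zero has occurred, $\theta_n$ may be infinite). $\theta_{\lambda_n}$ denotes $\theta_m$ evaluated at the random index $m=\lambda_n$. *)

(* Defs.v *)
(* MathComp-Analysis. *)
From HB Require Import structures.
From mathcomp Require Import all_boot all_order all_algebra.
From mathcomp Require Import all_classical all_reals all_analysis.
Set Implicit Arguments.
Unset Strict Implicit.
Unset Printing Implicit Defensive.
Import Order.TTheory GRing.Theory Num.Theory.
Import numFieldNormedType.Exports.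

Local Open Scope classical_set_scope.
Local Open Scope ring_scope.
Local Open Scope ereal_scope.

Definition run_distribution (R : realType) (p : nat -> R) : Prop :=
  [/\ forall k, (0 <= p k)%R,
      \sum_(0 <= k <oo) (p k)%:E = 1 &
      \sum_(0 <= k <oo) (k%:R * p k)%R%:E < +oo].

Definition transition (R : realType) (p : nat -> R) (i j : nat) : R :=
  if i is i'.+1 then (j == i')%:R else p j.

(* The Markov property and the transition probabilities are expressed jointly,
   with P(M_{n+1} = j | M_0 = a_0, ..., M_n = a_n) multiplied out so that
   conditioning events of probability 0 need no separate treatment. *)
Definition markov_chain (R : realType) (d : measure_display)
    (T : measurableType d) (P : probability T R) (Q : nat -> nat -> R)
    (M : nat -> {mfun T >-> nat}) : Prop :=
  forall (n : nat) (a : nat -> nat) (j : nat),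
    P [set w | (forall i, (i <= n)%N -> M i w = a i) /\ M n.+1 w = j]
    = P [set w | forall i, (i <= n)%N -> M i w = a i] * (Q (a n) j)%:E.

Definition stationary_start (R : realType) (d : measure_display)
    (T : measurableType d) (P : probability T R) (Q : nat -> nat -> R)
    (M : nat -> {mfun T >-> nat}) : Prop :=
  forall j : nat,
    \sum_(0 <= i <oo) (P [set w | M 0%N w = i] * (Q i j)%:E)
    = P [set w | M 0%N w = j].

(* The symbols 0 and 1 are encoded as false and true. *)
Definition binary_renewal (R : realType) (d : measure_display)
    (T : measurableType d) (P : probability T R) (X : nat -> T -> bool) : Prop :=
  exists (p : nat -> R) (M : nat -> {mfun T >-> nat}),
    [/\ run_distribution p,
        markov_chain P (transition p) M,
        stationary_start P (transition p) M &
        forall n w, X n w = (M n w != 0%N)].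

Definition observed (x : nat -> bool) (n : nat) : seq bool := mkseq x n.+1.

(* The supremum is attained unless X_i = 1 for all i > n, and is then +oo. *)
Definition run_length (R : realType) (x : nat -> bool) (n : nat) : \bar R :=
  ereal_sup [set k%:R%:E | k in
    [set k : nat | forall i, (n < i <= n + k)%N -> x i = true]].

(* E(f | Y) for a random variable Y with at most countably many values, as the
   average of f over the level set of Y; it is 0 on level sets of
   probability 0. *)
Definition discrete_cond_exp (R : realType) (d : measure_display)
    (T : measurableType d) (P : probability T R) (S : Type) (Y : T -> S)
    (f : T -> \bar R) (w : T) : \bar R :=
  let A := [set v | Y v = Y w] in
  ((fine (P A))^-1)%R%:E * \int[P]_(v in A) f v.

Definition theta (R : realType) (d : measure_display)
    (T : measurableType d) (P : probability T R) (X : nat -> T -> bool)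
    (n : nat) : T -> \bar R :=
  discrete_cond_exp P (fun v => observed (X^~ v) n)
    (fun v => run_length R (X^~ v) n).

(* None encodes the value infinity. *)
Definition stopping_time (tau : (nat -> bool) -> option nat) : Prop :=
  forall (k : nat) (x y : nat -> bool),
    (forall i, (i <= k)%N -> x i = y i) -> (tau x = Some k <-> tau y = Some k).

Definition ext_time (R : realType) (t : option nat) : \bar R :=
  if t is Some k then k%:R%:E else +oo.

(* Strict inequality is demanded below infinity only, so that the value
   infinity is not ruled out. *)
Definition strictly_increasing_times
    (lambda : nat -> (nat -> bool) -> option nat) : Prop :=
  forall (n : nat) (x : nat -> bool),
    match lambda n x, lambda n.+1 x with
    | Some k, Some m => is_true (k < m)%N
    | _, None => True
    | None, Some _ => False
    end.

(* Set to 0 when lambda_n is infinite. *)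
Definition estimation_error (R : realType) (d : measure_display)
    (T : measurableType d) (P : probability T R) (X : nat -> T -> bool)
    (lambda : nat -> (nat -> bool) -> option nat) (h : nat -> seq bool -> R)
    (n : nat) (w : T) : \bar R :=
  if lambda n (X^~ w) is Some m
  then `| (h n (observed (X^~ w) m))%:E - theta P X m w |
  else 0.

(* Main.v *)
(* Let T k be the probability that a run of ones has length at least k.  If T
   vanishes beyond N, then theta = 0 after a run of exactly N ones, and such runs
   occur with positive frequency.  Since lambda_n / n tends to 1, the stopping
   times cannot avoid them, so an estimator that is consistent for T must be
   close to 0 at one of these times, before some time L, with probability at
   least 1/2.  Now let a fraction 1/N' of the runs of length N grow to length
   N' >> L: up to time L the law of the process is bounded below by a fixed
   multiple of the old one, while theta after N ones becomes at least 1/4.  As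
   this adds only about T N to the mean, the procedure can be iterated with
   summable costs, and the limit law defeats the estimator infinitely often with
   positive probability. *)
Require Import Defs.
From HB Require Import structures.
From mathcomp Require Import all_boot all_order all_algebra.
From mathcomp Require Import all_classical all_reals all_analysis.
From mathcomp Require Import measurable_realfun.
From mathcomp Require Import zify ring lra.
Set Implicit Arguments.
Unset Strict Implicit.
Unset Printing Implicit Defensive.
Import Order.TTheory GRing.Theory Num.Theory.
Import numFieldNormedType.Exports.

Local Open Scope classical_set_scope.
Local Open Scope ring_scope.

(** * Survival functions and inverse-transform sampling *)

Section SurvivalFunctions.
Context {R : realType}.
Implicit Types T : nat -> R.

(** If no renewal process defeats the estimator, its error tends to [0] almost surely under every
    renewal law. This one assumption supplies the consistency used at each stage, and the limit law
    finally contradicts it. Long runs cannot be dodged for a counting reason. For large [s],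
    [lambda (K * s)] is at most [K.+1 * s], so the strictly increasing values [lambda n] with
    [n1 <= n <= K * s] miss at most [s + n1] times of that range. Runs of length [N] have a fixed
    positive frequency, and [K] is taken so large that, with high probability, more than [s + n1] of
    them start before time [K * s]. The laws are carried by survival functions because the
    modification is then local: values up to [N] stay as they are, and the effect on the mean is
    read off from a plain sum. *)

Definition survival T : Prop :=
  [/\ T 0 = 1, forall k, T k.+1 <= T k, forall k, 0 <= T k &
      exists C, forall n, \sum_(k < n) T k <= C].

Definition gap_law T (k : nat) : R := T k - T k.+1.

(** Since [T k] is the probability of a run of at least [k] ones, this is [1 + mu], and [init] is
    the stationary distribution of the chain. *)
Definition total T : R := limn (series T).

Definition init T (k : nat) : R := T k / total T.

Definition path_weight T (a : nat -> nat) (n : nat) : R :=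
  init T (a 0) * \prod_(i < n) transition (gap_law T) (a i) (a i.+1).

Lemma gap_law_ge0 T k : survival T -> 0 <= gap_law T k.
Proof. by move=> [_ h _ _]; rewrite subr_ge0. Qed.

Lemma sum_gap_law T n : survival T -> \sum_(k < n) gap_law T k = 1 - T n.
Proof.
move=> [T0 _ _ _]; elim: n => [|n IH]; first by rewrite big_ord0 T0 subrr.
by rewrite big_ord_recr /= IH /gap_law; ring.
Qed.

Lemma survival_series T : survival T -> cvgn (series T).
Proof.
move=> [_ _ T_ge0 [C hC]]; apply: nondecreasing_is_cvgn.
  by apply/nondecreasing_seqP => n; rewrite seriesEnat /= big_nat_recr//= lerDl.
by exists C => _ [n _ <-]; rewrite /series /= big_mkord.
Qed.

Lemma survival_cvg0 T : survival T -> T @ \oo --> 0.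
Proof. by move=> hT; apply: cvg_series_cvg_0; exact: survival_series. Qed.

Lemma sum_le_total T n : survival T -> \sum_(k < n) T k <= total T.
Proof.
move=> hT; have [_ _ T_ge0 _] := hT.
have := @nondecreasing_cvgn_le R (series T) _ (survival_series hT) n.
rewrite /series /= big_mkord; apply.
by apply/nondecreasing_seqP => m; rewrite big_nat_recr//= lerDl.
Qed.

Lemma total_ge1 T : survival T -> 1 <= total T.
Proof.
by move=> hT; have := sum_le_total 1 hT; rewrite big_ord1; have [-> _ _ _] := hT.
Qed.

Lemma total_le T C : survival T -> (forall n, \sum_(k < n) T k <= C) -> total T <= C.
Proof.
move=> hT hC; apply: limr_le; first exact: survival_series.
by near=> n; rewrite /series /= big_mkord.
Unshelve. all: by end_near. Qed.

Lemma init_ge0 T k : survival T -> 0 <= init T k.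
Proof.
move=> hT; rewrite divr_ge0//; first by case: hT.
by rewrite (le_trans ler01)// total_ge1.
Qed.

Lemma transition_ge0 T i j : survival T -> 0 <= transition (gap_law T) i j.
Proof. by case: i => [|i] hT /=; [exact: gap_law_ge0|exact: ler0n]. Qed.

Lemma path_weight_ge0 T a n : survival T -> 0 <= path_weight T a n.
Proof.
move=> hT; rewrite mulr_ge0 ?init_ge0// prodr_ge0// => i _.
exact: transition_ge0.
Qed.

Lemma path_weightS T a n : path_weight T a n.+1 =
  path_weight T a n * transition (gap_law T) (a n) (a n.+1).
Proof. by rewrite /path_weight big_ord_recr /= mulrA. Qed.

Lemma eq_path_weight T a b n : (forall i, (i <= n)%N -> a i = b i) ->
  path_weight T a n = path_weight T b n.
Proof.
move=> ab; rewrite /path_weight ab//; congr (_ * _); apply: eq_bigr => i _.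
by rewrite !ab// 1?ltnW.
Qed.

Lemma init_sum1 T : survival T -> (fun n => \sum_(k < n) init T k) @ \oo --> (1 : R).
Proof.
move=> hT; have tgt0 : 0 < total T by rewrite (lt_le_trans ltr01)// total_ge1.
have -> : (fun n => \sum_(k < n) init T k) = (fun n => (total T)^-1 * series T n).
  apply/funext => n; rewrite /series /= big_mkord mulr_sumr.
  by apply: eq_bigr => k _; rewrite mulrC.
rewrite -[X in _ --> X](mulVf (lt0r_neq0 tgt0)).
by apply: cvgM; [exact: cvg_cst|exact: survival_series].
Qed.

End SurvivalFunctions.

(* Inverse-transform sampling from the cumulative distribution function [F]:
   a uniform [u] is replaced by the index of the cell [F j <= u < F j.+1] that
   contains it, together with its relative position in that cell, which is
   again uniform and independent of the index. *)
Section Sampler.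
Context {R : realType}.

(** The default [0] is never reached when [F] is a [cdf] and [u < 1]. *)
Definition sampler_index (F : nat -> R) (u : R) : nat :=
  if pselect (exists j, u < F j.+1) is left ex then ex_minn ex else 0%N.

Definition sampler (F : nat -> R) (u : R) : nat * R :=
  (sampler_index F u, (u - F (sampler_index F u)) /
    (F (sampler_index F u).+1 - F (sampler_index F u))).

Definition cdf (F : nat -> R) : Prop :=
  [/\ F 0 = 0, forall k, F k <= F k.+1 & F @ \oo --> (1 : R)].

Lemma cdf_mono F : cdf F -> {homo F : m n / (m <= n)%N >-> m <= n}.
Proof. by move=> [_ h _]; apply/nondecreasing_seqP. Qed.

Lemma cdf_le1 F n : cdf F -> F n <= 1.
Proof.
move=> hF; have [_ _ hl] := hF; rewrite -(cvg_lim (@Rhausdorff R) hl).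
apply: nondecreasing_cvgn_le; first exact: cdf_mono.
by apply/cvg_ex; exists 1.
Qed.

Lemma cdf_ex F u : cdf F -> u < 1 -> exists j, u < F j.+1.
Proof.
move=> [_ _ hl] u1; have := cvgr_gt _ hl _ u1.
by move=> [n _ hn]; exists n; apply: hn => /=.
Qed.

Lemma sampler_cell F u : cdf F -> 0 <= u < 1 ->
  F (sampler F u).1 <= u < F (sampler F u).1.+1.
Proof.
move=> hF /andP[u0 u1]; rewrite /sampler /= /sampler_index.
case: pselect => [ex|]; last by move/(_ (cdf_ex hF u1)).
case: ex_minnP => [[|m] hm mmin]; rewrite hm andbT.
  by have [-> _ _] := hF.
by rewrite leNgt; apply/negP => /mmin; rewrite ltnn.
Qed.

Lemma sampler_eq F u j : cdf F -> 0 <= u < 1 ->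
  (sampler F u).1 = j <-> F j <= u < F j.+1.
Proof.
move=> hF hu; split=> [<-|/andP[h1 h2]]; first exact: sampler_cell.
have /andP[h3 h4] := sampler_cell hF hu.
apply/eqP; rewrite eqn_leq; apply/andP; split; rewrite leqNgt; apply/negP => lt.
- by have := lt_le_trans h2 (cdf_mono hF lt); rewrite ltNge h3.
- by have := lt_le_trans h4 (cdf_mono hF lt); rewrite ltNge h1.
Qed.

Lemma sampler_res F u : cdf F -> 0 <= u < 1 -> 0 <= (sampler F u).2 < 1.
Proof.
move=> hF hu; have /andP[h3 h4] := sampler_cell hF hu.
rewrite /sampler /= in h3 h4 *; set j := sampler_index F u in h3 h4 *.
have d : 0 < F j.+1 - F j by rewrite subr_gt0 (le_lt_trans h3).
apply/andP; split; first by apply: divr_ge0; [rewrite subr_ge0|exact: ltW].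
by rewrite ltr_pdivrMr// mul1r ltrD2r.
Qed.

Lemma sampler_gt0 F u : cdf F -> 0 <= u < 1 ->
  0 < F (sampler F u).1.+1 - F (sampler F u).1.
Proof.
move=> hF hu; have /andP[h3 h4] := sampler_cell hF hu.
by rewrite subr_gt0 (le_lt_trans h3).
Qed.

End Sampler.

Section RenewalTrajectory.
Context {R : realType} (T : nat -> R) (hT : survival T).

Definition init_cdf (k : nat) : R := \sum_(j < k) init T j.
Definition gap_cdf (k : nat) : R := 1 - T k.

Lemma cdf_init : cdf init_cdf.
Proof.
split; rewrite /init_cdf ?big_ord0//; last exact: init_sum1.
by move=> k; rewrite big_ord_recr /= lerDl init_ge0.
Qed.

Lemma cdf_gap : cdf gap_cdf.
Proof.
have [T0 dT _ _] := hT; split; rewrite /gap_cdf ?T0 ?subrr//.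
  by move=> k; rewrite lerD2l lerN2.
rewrite -[X in _ --> X]subr0; apply: cvgB; first exact: cvg_cst.
exact: survival_cvg0.
Qed.

(** One uniform number drives the whole path: after the initial draw, randomness is consumed only at
    zeros, and the residue of each draw serves as the uniform number for the next. *)
Fixpoint trajectory (n : nat) (u : R) : nat * R :=
  if n is n'.+1 then
    if (trajectory n' u).1 is i.+1 then (i, (trajectory n' u).2)
    else sampler gap_cdf (trajectory n' u).2
  else sampler init_cdf u.

Lemma trajectory_res n u : 0 <= u < 1 -> 0 <= (trajectory n u).2 < 1.
Proof.
move=> hu; elim: n => [|n IH] /=; first exact: sampler_res cdf_init hu.
by case: (trajectory n u).1 => [|//]; exact: sampler_res cdf_gap IH.
Qed.

Lemma trajectory_gt0 n u : 0 <= u < 1 ->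
  0 < path_weight T (fun i => (trajectory i u).1) n.
Proof.
move=> hu; elim: n => [|n IH].
  rewrite /path_weight big_ord0 mulr1 /=.
  have := sampler_gt0 cdf_init hu.
  by rewrite /init_cdf big_ord_recr /= addrAC subrr add0r.
rewrite path_weightS mulr_gt0//= -/(trajectory n u).
case: (trajectory n u).1 => [|i] /=; last by rewrite eqxx ltr01.
have := sampler_gt0 cdf_gap (trajectory_res n hu).
by rewrite /gap_cdf /gap_law /=; lra.
Qed.

Let rescale (u l w f g : R) : w != 0 ->
  ((u - l) / w - f) / g = (u - (l + w * f)) / (w * g).
Proof.
move=> w0; have -> : u - (l + w * f) = w * ((u - l) / w - f) by field.
by rewrite -mulf_div divff// mul1r.
Qed.

(** The invariant behind the single [u]: the points that follow [a] form an interval as long as the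
    path weight, and the residue maps it affinely onto the unit interval, so the next draw splits it
    in the proportions of [gap_cdf]. A countdown step keeps the interval or empties it. *)
Lemma trajectory_cell (a : nat -> nat) n : exists l : R,
  [/\ 0 <= l, l + path_weight T a n <= 1 & forall u, 0 <= u < 1 ->
     ((forall i, (i <= n)%N -> (trajectory i u).1 = a i) <->
       l <= u < l + path_weight T a n) /\
     (l <= u < l + path_weight T a n ->
       (trajectory n u).2 = (u - l) / path_weight T a n)].
Proof.
elim: n => [|n [l [l0 l1 IH]]].
  exists (init_cdf (a 0)).
  have w0 : path_weight T a 0 = init T (a 0) by rewrite /path_weight big_ord0 mulr1.
  have e : init_cdf (a 0) + path_weight T a 0 = init_cdf (a 0).+1.
    by rewrite /init_cdf big_ord_recr /= w0.
  rewrite e; split; first by have [<- _ _] := cdf_init; exact: cdf_mono cdf_init _ _ _.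
    exact: cdf_le1 cdf_init.
  move=> u hu; split.
    have := sampler_eq (a 0) cdf_init hu => E; split.
      by move=> /(_ 0%N (leqnn _))/E.
    by move=> /E h [|//] _.
  move=> /(sampler_eq (a 0) cdf_init hu) /= h.
  have -> : path_weight T a 0 = init_cdf (a 0).+1 - init_cdf (a 0) by rewrite -e; ring.
  by rewrite -h.
have wge := path_weight_ge0 a n hT.
rewrite path_weightS; case ean : (a n) => [|i] /=.
- exists (l + path_weight T a n * gap_cdf (a n.+1)).
  set w := path_weight T a n in l1 wge IH *; set F := gap_cdf.
  have eF : F (a n.+1).+1 = F (a n.+1) + gap_law T (a n.+1).
    by rewrite /F /gap_cdf /gap_law; ring.
  have -> : l + w * F (a n.+1) + w * gap_law T (a n.+1) = l + w * F (a n.+1).+1.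
    by rewrite eF; ring.
  have F0 k : 0 <= F k by have [<- _ _] := cdf_gap; exact: cdf_mono cdf_gap _ _ _.
  have F1 k : F k <= 1 by exact: cdf_le1 cdf_gap.
  split; first by rewrite addr_ge0// mulr_ge0.
    by apply: le_trans l1; rewrite lerD2l ler_piMr.
  move=> u hu; have [E1 E2] := IH u hu.
  have key : l <= u < l + w -> (trajectory n u).1 = a n ->
      ((trajectory n.+1 u).1 = a n.+1 <->
       l + w * F (a n.+1) <= u < l + w * F (a n.+1).+1) /\
      ((trajectory n.+1 u).1 = a n.+1 -> (trajectory n.+1 u).2 =
        (u - (l + w * F (a n.+1))) / (w * gap_law T (a n.+1))).
    move=> hlu hn; have w_gt0 : 0 < w by move: hlu; lra.
    have hr := E2 hlu; rewrite /= -/(trajectory n u) hn ean; split.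
      apply: iff_trans (sampler_eq _ cdf_gap (trajectory_res n hu)) _.
      rewrite hr lter_pdivlMr// ltr_pdivrMr// lerBrDl ltrBlDl.
      by rewrite ![_ * w]mulrC.
    rewrite /sampler /= hr -/F => ->; rewrite eF [F _ + _ - _]addrAC subrr add0r.
    by apply: rescale; exact: lt0r_neq0.
  have inner : l + w * F (a n.+1) <= u < l + w * F (a n.+1).+1 -> l <= u < l + w.
    move=> /andP[h1 h2]; apply/andP; split.
      by apply: le_trans h1; rewrite lerDl mulr_ge0.
    by apply: lt_le_trans h2 _; rewrite lerD2l ler_piMr.
  split.
    split=> [h|h].
      have h' i : (i <= n)%N -> (trajectory i u).1 = a i by move=> ?; apply: h; lia.
      by apply/(proj1 (key _ _)); [exact/E1|exact: h'|exact: h].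
    have h1 := inner h; have h2 := (E1.2 h1).
    move=> i; rewrite leq_eqVlt => /orP[/eqP ->|]; last by move=> ?; apply: h2.
    by apply/(proj1 (key _ _)) => //; apply: h2.
  move=> h; have h1 := inner h; have h2 := (E1.2 h1).
  by apply: (key _ _).2 => //; [exact: h2|apply/(proj1 (key _ _)) => //; apply: h2].
- exists l; set w := path_weight T a n in l1 wge IH *.
  have [e|ne] := eqVneq (a n.+1) i.
    rewrite mulr1; split=> // u hu; have [E1 E2] := IH u hu; split.
      split=> [h|/E1 h].
        by apply/E1 => j jn; apply: h; lia.
      move=> j; rewrite leq_eqVlt => /orP[/eqP ->|]; last by move=> ?; apply: h.
      by rewrite /= -/(trajectory n u) h// ean.
    move=> h; rewrite /= -/(trajectory n u).
    by rewrite ((E1.2 h) n (leqnn n)) ean /= (E2 h).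
  rewrite mulr0 addr0; split=> //; first by lra.
  move=> u hu; have [E1 E2] := IH u hu; split; last by lra.
  split; last by lra.
  move=> h; have := h n.+1 (leqnn _).
  by rewrite /= -/(trajectory n u) (h n (leqnSn n)) ean /= => e; rewrite e eqxx in ne.
Qed.

Lemma trajectory_desc n u i : (trajectory n u).1 = i.+1 ->
  (trajectory n.+1 u).1 = i.
Proof. by rewrite /= -/(trajectory n u) => ->. Qed.

End RenewalTrajectory.

(** * The chain on the unit interval and its path events *)

Definition cylinder (Omega : Type) (M : nat -> Omega -> nat) (a : nat -> nat)
    (n : nat) : set Omega :=
  [set w | forall i, (i <= n)%N -> M i w = a i].

Definition path_event (Omega : Type) (M : nat -> Omega -> nat)
    (Phi : (nat -> nat) -> Prop) : set Omega :=
  [set w | Phi (fun i => M i w)].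

Definition depends_upto (A : Type) (Phi : (nat -> A) -> Prop) (L : nat) : Prop :=
  forall a b, (forall i, (i <= L)%N -> a i = b i) -> Phi a -> Phi b.

(* A version of the chain of the renewal process with survival function [T] in
   which impossible transitions never occur, rather than almost never. *)
Definition sure_chain (R : realType) (T : nat -> R) (d : measure_display)
    (Omega : measurableType d) (P : probability Omega R)
    (M : nat -> {mfun Omega >-> nat}) : Prop :=
  [/\ forall a n, P (cylinder M a n) = (path_weight T a n)%:E,
      forall n w i, M n w = i.+1 -> M n.+1 w = i &
      forall n w, 0 < path_weight T (fun i => M i w) n].

Section UnitInterval.
Context {R : realType}.

Definition unit_interval : set R := `[0, 1[.

Lemma measurable_unit_interval : measurable unit_interval.
Proof. exact: measurable_itv. Qed.

Definition unit_uniform := mrestr (@lebesgue_measure R) measurable_unit_interval.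

HB.instance Definition _ := Measure.on unit_uniform.

Lemma unit_uniformT : unit_uniform setT = 1%E.
Proof.
rewrite /unit_uniform /mrestr setTI /unit_interval lebesgue_measure_itv /= lte_fin ltr01.
by rewrite sube0.
Qed.

HB.instance Definition _ :=
  Measure_isProbability.Build _ _ _ unit_uniform unit_uniformT.

Variables (T : nat -> R) (hT : survival T).

(** Points outside the unit interval are null but still belong to the space, and [sure_chain]
    constrains every point, so they are given the path of [0]. *)
Definition chain_state (n : nat) (u : R) : nat :=
  (trajectory T n (if 0 <= u < 1 then u else 0)).1.

Lemma cylinder_chain_state a n : exists l : R,
  [/\ 0 <= l, l + path_weight T a n <= 1,
     cylinder chain_state a n `&` unit_interval =
       [set` `[l, l + path_weight T a n[] &
     measurable (cylinder chain_state a n : set (measurableTypeR R))].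
Proof.
have [l [l0 l1 hl]] := trajectory_cell hT a n.
have e : cylinder chain_state a n `&` unit_interval =
       [set` `[l, l + path_weight T a n[].
  apply/seteqP; split=> u; rewrite /cylinder /chain_state /unit_interval /= !in_itv /=.
    by move=> [h hu]; rewrite hu in h; apply/(hl u hu).1.
  move=> h; have hu : 0 <= u < 1 by case/andP: h; lra.
  by split=> //; rewrite hu; apply/(hl u hu).1.
exists l; split=> //.
have -> : cylinder chain_state a n = (cylinder chain_state a n `&` unit_interval) `|`
    (~` unit_interval `&` (if `[< cylinder chain_state a n 0 >] then setT else set0)).
  apply/seteqP; split=> u.
    move=> h; have [hu|hu] := pselect (unit_interval u); first by left.
    right; split=> //; rewrite asboolT// => i hi.
    rewrite -(h i hi) /chain_state lexx ltr01 /=.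
    by move: hu; rewrite /unit_interval /= in_itv /= => /negP/negbTE ->.
  case=> [[]//|[hu]]; case: asboolP => //= h _ i hi.
  rewrite -(h i hi) /chain_state lexx ltr01 /=.
  by move: hu; rewrite /unit_interval /= in_itv /= => /negP/negbTE ->.
apply: measurableU; first by rewrite e; exact: measurable_itv.
apply: measurableI; first by apply: measurableC; exact: measurable_unit_interval.
by case: ifP.
Qed.

Lemma measurable_chain_state n : 
  @measurable_fun _ _ (measurableTypeR R) nat setT (chain_state n).
Proof.
move=> _ Y _; rewrite setTI.
have -> : chain_state n @^-1` Y = \bigcup_(s : seq nat)
    (if `[< Y (nth 0%N s n) >] then cylinder chain_state (nth 0%N s) n else set0).
  apply/seteqP; split=> u /=.
    move=> hY; exists (mkseq (chain_state^~ u) n.+1) => //.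
    rewrite nth_mkseq// asboolT// => i hi; by rewrite nth_mkseq.
  by move=> [s _]; case: asboolP => // hY /(_ n (leqnn n)) ->.
apply: countable_bigcupT_measurable; first exact: countableP.
by move=> s; case: ifP => // _; have [l []] := cylinder_chain_state (nth 0%N s) n.
Qed.

Lemma sure_chain_exists : exists (d : measure_display) (Omega : measurableType d)
  (P : probability Omega R) (M : nat -> {mfun Omega >-> nat}), sure_chain T P M.
Proof.
exists _, (measurableTypeR R), unit_uniform.
exists (fun n => @mfun_Sub _ _ (measurableTypeR R) nat _
  (mem_set (measurable_chain_state n))); split.
- move=> a n; have [l [l0 l1 e mc]] := cylinder_chain_state a n.
  rewrite [LHS](_ : _ = lebesgue_measure (cylinder chain_state a n `&` unit_interval))//.
  rewrite e lebesgue_measure_itv /= lte_fin ltrDl.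
  have := path_weight_ge0 a n hT; rewrite le_eqVlt => /orP[/eqP <-|h].
    by rewrite ltxx.
  by rewrite h -EFinD addrAC subrr add0r.
- by move=> n u i; exact: trajectory_desc.
- move=> n u; apply: trajectory_gt0 => //.
  by case: ifP => // _; rewrite lexx ltr01.
Qed.

End UnitInterval.

Section PathEvents.
Context {R : realType} {d : measure_display} {Omega : measurableType d}
  {P : probability Omega R} {M : nat -> {mfun Omega >-> nat}}.
Implicit Types Phi : (nat -> nat) -> Prop.

Lemma measurable_cylinder a n : measurable (cylinder M a n).
Proof.
rewrite (_ : cylinder M a n = \bigcap_(i in [set i | (i <= n)%N]) (M i @^-1` [set a i])).
  by apply: bigcap_measurableType => k _; exact: measurable_funPTI.
by apply/seteqP; split=> w h i hi; exact: h.
Qed.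

(** Cylinders are indexed by the codes of finite sequences, independently of the chain, so that the
    series of two chains can be compared term by term. The size condition leaves one code per
    path. *)
Definition path_piece Phi L (k : nat) : set Omega :=
  if (pickle_inv k : option (seq nat)) is Some s then
    if `[< size s = L.+1 /\ Phi (nth 0%N s) >] then cylinder M (nth 0%N s) L else set0
  else set0.

Lemma path_eventE Phi L : depends_upto Phi L ->
  path_event M Phi = \bigcup_k path_piece Phi L k.
Proof.
move=> hPhi; apply/seteqP; split=> w.
  rewrite /path_event /= => h.
  exists (pickle (mkseq (fun i => M i w) L.+1)) => //.
  rewrite /path_piece pickleK_inv asboolT.
    by move=> i hi; rewrite nth_mkseq.
  split; first by rewrite size_mkseq.
  by apply: hPhi h => i hi; rewrite nth_mkseq.
move=> [k _]; rewrite /path_piece; case: pickle_inv => // s; case: asboolP => // -[_ h] hw.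
by apply: hPhi h => i hi; rewrite hw.
Qed.

Lemma measurable_path_piece Phi L k : measurable (path_piece Phi L k).
Proof.
rewrite /path_piece; case: pickle_inv => // s; case: ifP => // _.
exact: measurable_cylinder.
Qed.

Lemma measurable_path_event Phi L : depends_upto Phi L ->
  measurable (path_event M Phi).
Proof.
move=> /path_eventE ->; apply: bigcupT_measurable => k.
exact: measurable_path_piece.
Qed.

Lemma trivIset_path_piece Phi L : trivIset setT (path_piece Phi L).
Proof.
apply/trivIsetP => i j _ _ ij; rewrite -subset0 => w; rewrite /path_piece.
have Ki := @pickle_invK (seq nat) i; have Kj := @pickle_invK (seq nat) j.
case: (pickle_inv i) Ki => [s|] /=; last by move=> _ [].
case: (pickle_inv j) Kj => [t|] /=; last by move=> _ _ [].
move=> et es; case: asboolP => [[ss _]|_ []//]; case: asboolP => [[st _]|_ []//].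
move=> [hs ht]; have e : s = t.
  apply: (@eq_from_nth _ 0%N); first by rewrite ss st.
  by move=> k; rewrite ss ltnS => hk; rewrite -hs// -ht.
by move: ij; rewrite -es -et e eqxx.
Qed.

Lemma path_event_measure Phi L : depends_upto Phi L ->
  P (path_event M Phi) = (\sum_(0 <= k <oo) P (path_piece Phi L k))%E.
Proof.
move=> h; rewrite (path_eventE h) measure_semi_bigcup//.
- by move=> k; exact: measurable_path_piece.
- exact: trivIset_path_piece.
- by apply: bigcupT_measurable => k; exact: measurable_path_piece.
Qed.

End PathEvents.

(** This transfers an event from the law of a stage to the limit law, which lives on another space:
    the two measures meet only in the weights of the same finite paths. *)
Lemma path_event_le (R : realType) (T T' : nat -> R)
    (d : measure_display) (Omega : measurableType d) (P : probability Omega R)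
    (M : nat -> {mfun Omega >-> nat})
    (d' : measure_display) (Omega' : measurableType d') (P' : probability Omega' R)
    (M' : nat -> {mfun Omega' >-> nat}) (Phi : (nat -> nat) -> Prop) L (c : R) :
  sure_chain T P M -> sure_chain T' P' M' -> depends_upto Phi L -> 0 <= c ->
  (forall a, c * path_weight T a L <= path_weight T' a L) ->
  (c%:E * P (path_event M Phi) <= P' (path_event M' Phi))%E.
Proof.
move=> [cylM _ _] [cylM' _ _] hPhi c0 hw.
rewrite !(path_event_measure hPhi) -nneseriesZl//.
apply: lee_nneseries => k _; first by rewrite mule_ge0.
rewrite /path_piece; case: pickle_inv => [s|]; last by rewrite !measure0 mule0.
case: ifP => _; last by rewrite !measure0 mule0.
by rewrite cylM cylM' -EFinM lee_fin.
Qed.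

(** * The renewal process and its conditional expectations *)

Section RenewalProcess.
Context {R : realType} {T : nat -> R} (hT : survival T).

Lemma gap_law_mean_le n : \sum_(k < n) k%:R * gap_law T k <= total T.
Proof.
(* Summation by parts; the boundary term stays on the left, where it is nonnegative. *)
have e : \sum_(k < n) k%:R * gap_law T k + n%:R * T n = \sum_(k < n) T k.+1.
  elim: n => [|n IH]; first by rewrite !big_ord0 mul0r addr0.
  rewrite !big_ord_recr /= -IH /gap_law -natr1; ring.
have [_ _ T0 _] := hT; have := sum_le_total n.+1 hT.
rewrite big_ord_recl /= (eq_bigr (fun k : 'I_n => T k.+1))// -e => h.
have := T0 0%N; have : 0 <= n%:R * T n by rewrite mulr_ge0.
by move: h; lra.
Qed.

Lemma run_distribution_gap_law : run_distribution (gap_law T).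
Proof.
split; first by move=> k; exact: gap_law_ge0.
  apply: cvg_lim => //.
  rewrite (_ : (fun n => _) = (fun n => (1 - T n)%:E)); last first.
    by apply/funext => n; rewrite sumEFin big_mkord sum_gap_law.
  apply: cvg_EFin; first by near=> n.
  rewrite -[X in _ --> X]subr0; apply: cvgB; first exact: cvg_cst.
  exact: survival_cvg0.
apply: (@le_lt_trans _ _ (total T)%:E); last exact: ltry.
apply: lime_le.
  by apply: is_cvg_nneseries => k _ _; rewrite lee_fin mulr_ge0// gap_law_ge0.
by near=> n; rewrite sumEFin big_mkord lee_fin gap_law_mean_le.
Unshelve. all: by end_near. Qed.

(** Only two states lead to [j]: zero, by a fresh run, and [j.+1], by the countdown. Their
    contributions telescope, and the bound on [n] keeps both in the sum. *)
Lemma init_balance j n : (j.+1 < n)%N ->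
  \sum_(i < n) init T i * transition (gap_law T) i j = init T j.
Proof.
case: n => // n; rewrite ltnS => jn; rewrite big_ord_recl /= (bigD1 (Ordinal jn))//=.
rewrite eqxx mulr1 big1 ?addr0.
  by rewrite /init /gap_law; have [-> _ _ _] := hT; ring.
move=> i /eqP ij; rewrite (_ : (j == i) = false) ?mulr0//.
by apply/eqP => e; apply: ij; apply/val_inj; rewrite /= -e.
Qed.

Context {d : measure_display} {Omega : measurableType d} {P : probability Omega R}
  {M : nat -> {mfun Omega >-> nat}} (hM : sure_chain T P M).

Lemma sure_chain_binary_renewal : binary_renewal P (fun n w => M n w != 0%N).
Proof.
have [cylM _ _] := hM; exists (gap_law T), M; split=> //.
- exact: run_distribution_gap_law.
- move=> n a j; rewrite [in RHS](_ : [set w | _] = cylinder M a n)// cylM.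
  pose b i := if (i <= n)%N then a i else j.
  rewrite (_ : [set w | _] = cylinder M b n.+1) ?cylM.
    rewrite path_weightS (@eq_path_weight _ _ b a) /b ?leqnn ?ltnn//.
    by move=> i ->.
  apply/seteqP; split=> w /=.
    move=> [h hj] i; rewrite /b; case: (leqP i n) => hi; first by rewrite h.
    by move=> hi'; rewrite (_ : i = n.+1)//; apply/eqP; rewrite eqn_leq hi hi'.
  move=> h; split; first by move=> i hi; rewrite h ?leqW// /b hi.
  by rewrite h// /b ltnn.
- move=> j; have M0 i : P [set w | M 0%N w = i] = (init T i)%:E.
    rewrite (_ : [set w | _] = cylinder M (fun=> i) 0).
      by rewrite cylM /path_weight big_ord0 mulr1.
    by apply/seteqP; split=> w /= h => [[|//] _|]; [|exact: (h 0%N)].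
  apply: cvg_lim => //; rewrite M0; apply: cvg_near_cst.
  near=> n; rewrite (eq_bigr (fun i => (init T i * transition (gap_law T) i j)%:E)).
    rewrite sumEFin big_mkord init_balance//; near: n; exact: nbhs_infty_gt.
  by move=> i _; rewrite M0 EFinM.
Unshelve. all: by end_near. Qed.

Lemma sure_chain_desc z w k i : M z w = k -> (i <= k)%N -> M (z + i)%N w = (k - i)%N.
Proof.
have [_ desc _] := hM; move=> hz; elim: i => [|i IH] ik; first by rewrite addn0 subn0.
by rewrite addnS; apply: desc; rewrite (IH (ltnW ik)) subnSK.
Qed.

Lemma sure_chain_ones z N w : M z.+1 w = N ->
  forall j, (z < j <= z + N)%N -> M j w != 0%N.
Proof.
move=> hN j hj; have -> : j = (z.+1 + (j - z.+1))%N by lia.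
by rewrite (sure_chain_desc hN); lia.
Qed.

Lemma run_length_sure_chain z t w : (t <= M z.+1 w)%N ->
  run_length R (fun i => M i w != 0%N) (z + t) = (M z.+1 w - t)%N%:R%:E.
Proof.
move=> tj; set j := M z.+1 w in tj *; apply/eqP; rewrite eq_le; apply/andP; split.
  apply: ge_ereal_sup => _ [k /= hk <-]; rewrite lee_fin ler_nat leqNgt; apply/negP => lt.
  have := hk (z.+1 + j)%N; rewrite (sure_chain_desc (erefl _) (leqnn _)) subnn.
  by move=> H; have /H : (z + t < z.+1 + j <= z + t + k)%N by lia.
apply: ereal_sup_ubound; exists (j - t)%N => //= i hi.
have -> : i = (z.+1 + (i - z.+1))%N by lia.
by rewrite (@sure_chain_desc z.+1 w j)//; lia.
Qed.

Lemma observed_eq (x y : nat -> bool) m :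
  observed x m = observed y m <-> forall i, (i <= m)%N -> x i = y i.
Proof.
split=> [e i im|e].
  by have := congr1 (fun s => nth false s i) e; rewrite !nth_mkseq.
by apply: (@eq_from_nth _ false); rewrite !size_mkseq// => i im; rewrite !nth_mkseq// e.
Qed.

(** The hidden states up to the zero at [z] can be read off the observations backwards, because a
    nonzero state is one more than its successor. After [z], the observations only say that the run
    has at least [t] ones. *)
Lemma level_set z t w : M z w = 0%N -> (forall i, (z < i <= z + t)%N -> M i w != 0%N) ->
  [set v | observed (fun i => M i v != 0%N) (z + t) =
           observed (fun i => M i w != 0%N) (z + t)] =
  [set v | cylinder M (fun i => M i w) z v /\ (t <= M z.+1 v)%N].
Proof.
have [_ desc _] := hM; move=> hz hi; apply/seteqP; split=> v /=.
  move=> /observed_eq e; split.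
    suff H k : (k <= z)%N -> M (z - k)%N v = M (z - k)%N w.
      by move=> i iz; have := H (z - i)%N (leq_subr _ _); rewrite subKn.
    elim: k => [|k IH] kz.
      have := e z (leq_addr _ _); rewrite subn0 hz eqxx => /negbFE/eqP //.
    have ek : (z - k)%N = (z - k.+1).+1 by lia.
    have := e (z - k.+1)%N; rewrite (leq_trans (leq_subr _ _) (leq_addr _ _)) => /(_ isT).
    move: (IH (ltnW kz)); rewrite ek.
    case Ev: (M (z - k.+1)%N v) => [|cv]; case Ew: (M (z - k.+1)%N w) => [|cw] //= E _.
    by rewrite (desc _ _ _ Ev) (desc _ _ _ Ew) in E; rewrite E.
  rewrite leqNgt; apply/negP => lt.
  have := sure_chain_desc (erefl (M z.+1 v)) (leqnn _); rewrite subnn => h0.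
  have hr : (z < z.+1 + M z.+1 v <= z + t)%N by lia.
  by have := e (z.+1 + M z.+1 v)%N; rewrite h0 hi// => /(_ (proj2 (andP hr))).
move=> [hc ht]; apply/observed_eq => i im; case: (leqP i z) => iz; first by rewrite hc.
rewrite hi ?iz//; have -> : i = (z.+1 + (i - z.+1))%N by lia.
by rewrite (sure_chain_desc (erefl (M z.+1 v)))//; lia.
Qed.

Lemma measurable_cylinder_next a z (Y : nat -> Prop) :
  measurable [set v | cylinder M a z v /\ Y (M z.+1 v)].
Proof.
apply: (@measurable_path_event _ _ M (fun x => (forall i, (i <= z)%N -> x i = a i) /\
  Y (x z.+1)) z.+1).
move=> x y xy [h1 h2]; split; last by rewrite -xy.
by move=> i iz; rewrite -xy ?h1// ltnW.
Qed.

Lemma cylinder_next_eq a z j : a z = 0%N ->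
  P [set v | cylinder M a z v /\ M z.+1 v = j] = (path_weight T a z * gap_law T j)%:E.
Proof.
have [cylM _ _] := hM; move=> az.
pose b i := if (i <= z)%N then a i else j.
rewrite (_ : [set v | _] = cylinder M b z.+1).
  rewrite cylM path_weightS (@eq_path_weight _ _ b a) /b ?leqnn ?ltnn ?az//.
  by move=> i ->.
apply/seteqP; split=> w /=.
  move=> [h hj] i; rewrite /b; case: (leqP i z) => hi; first by rewrite h.
  by move=> hi'; rewrite (_ : i = z.+1)//; apply/eqP; rewrite eqn_leq hi hi'.
move=> h; split; first by move=> i hi; rewrite h ?leqW// /b hi.
by rewrite h// /b ltnn.
Qed.

Lemma cylinder_next_ge a z t : a z = 0%N ->
  P [set v | cylinder M a z v /\ (t <= M z.+1 v)%N] = (path_weight T a z * T t)%:E.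
Proof.
have [cylM _ _] := hM; have [T0 _ _ _] := hT; move=> az; elim: t => [|t IH].
  rewrite T0 mulr1 -cylM; congr (P _); apply/seteqP; split=> w /=; first by case.
  by move=> hc; split.
have e : [set v | cylinder M a z v /\ (t <= M z.+1 v)%N] =
    [set v | cylinder M a z v /\ (t < M z.+1 v)%N] `|`
    [set v | cylinder M a z v /\ M z.+1 v = t].
  apply/seteqP; split=> w /=.
    by move=> [hc]; rewrite leq_eqVlt => /orP[/eqP <-|]; [right|left].
  by move=> [[hc /ltnW]|[hc ->]].
move: IH; rewrite e measureU//=; last 3 first.
- exact: (@measurable_cylinder_next a z (fun x => (t < x)%N)).
- exact: (@measurable_cylinder_next a z (fun x => x = t)).
- by rewrite -subset0 => w [[_ h] [_ h']]; move: h; rewrite h' ltnn.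
rewrite cylinder_next_eq// => h.
have /fineK hf : P [set v | cylinder M a z v /\ (t < M z.+1 v)%N] \is a fin_num.
  by apply: fin_num_measure; exact: (@measurable_cylinder_next a z (fun x => (t < x)%N)).
move: h; rewrite -hf -EFinD => -[h]; congr (_%:E).
by move: h; rewrite /gap_law; lra.
Qed.

(** A run longer than [t] would give the path weight [0], which [sure_chain] excludes at every
    point; so the remaining run length vanishes on the whole level set. *)
Lemma theta_eq0 z t w : M z w = 0%N -> (forall i, (z < i <= z + t)%N -> M i w != 0%N) ->
  (forall k, (t < k)%N -> T k = 0) ->
  theta P (fun n v => M n v != 0%N) (z + t) w = 0%E.
Proof.
have [_ _ pos] := hM; move=> hz hi hk; rewrite /theta /discrete_cond_exp /=.
rewrite (level_set hz hi) (eq_integral (cst 0%E)); first by rewrite integral0 mule0.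
move=> v; rewrite inE /= => -[hc ht]; rewrite run_length_sure_chain//.
have := pos z.+1 v; rewrite path_weightS hc// hz /=.
case: (ltnP t (M z.+1 v)) => [lt|le].
  by rewrite /gap_law !hk// ?subrr ?mulr0 ?ltxx// ltnW.
by move=> _; rewrite (_ : (_ - _)%N = 0%N)//; apply/eqP.
Qed.

(** Only runs of length exactly [k] are kept in the expectation: given a run of at least [t] ones,
    they have probability [gap_law T k / T t] and leave [k - t] ones to come. *)
Lemma theta_ge z t k w : M z w = 0%N -> (forall i, (z < i <= z + t)%N -> M i w != 0%N) ->
  0 < T t -> (t <= k)%N ->
  (((k - t)%N%:R * gap_law T k / T t)%:E <=
    theta P (fun n v => M n v != 0%N) (z + t) w)%E.
Proof.
have [_ _ pos] := hM; move=> hz hi Tt tk; rewrite /theta /discrete_cond_exp /=.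
rewrite (level_set hz hi) cylinder_next_ge//=.
set wt := path_weight _ _ _; have wt0 : 0 < wt by exact: pos.
set A := [set v | _].
have mA : measurable A by exact: (@measurable_cylinder_next _ z (fun x => (t <= x)%N)).
set B := [set v | cylinder M (fun i => M i w) z v /\ M z.+1 v = k].
have mB : measurable B by exact: (@measurable_cylinder_next _ z (fun x => x = k)).
have BA : B `<=` A by move=> v [h1 h2]; split; rewrite // h2.
have -> : ((k - t)%N%:R * gap_law T k / T t)%:E =
    ((wt * T t)^-1%:E * ((k - t)%N%:R%:E * P B))%E.
  rewrite cylinder_next_eq// -!EFinM; congr (_%:E); rewrite -/wt.
  by field; rewrite !lt0r_neq0.
rewrite lee_pmul2l ?lte_fin ?invr_gt0 ?(mulr_gt0 wt0 Tt)//.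
rewrite -integral_cst//.
rewrite (eq_integral (fun v => run_length R (fun i => M i v != 0%N) (z + t))); last first.
  move=> v; rewrite inE => -[hc hk]; rewrite run_length_sure_chain ?hk//.
apply: ge0_subset_integral => //; last first.
  move=> v [_ ht]; by rewrite run_length_sure_chain// lee_fin.
apply: (eq_measurable_fun (fun v => (M z.+1 v - t)%N%:R%:E)).
  by move=> v; rewrite inE => -[_ ht]; rewrite run_length_sure_chain.
apply: (@measurableT_comp _ _ _ _ _ _ (fun j : nat => (j - t)%N%:R%:E : \bar R)) => //.
exact: measurable_funP.
Qed.

End RenewalProcess.

(** * Measurability of the estimation error *)

Section EstimationError.
Context {R : realType} {d : measure_display} {Omega : measurableType d}
  {P : probability Omega R} {M : nat -> {mfun Omega >-> nat}}.
Variables (lambda : nat -> (nat -> bool) -> option nat) (h : nat -> seq bool -> R).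
Hypothesis lambda_stop : forall n, stopping_time (lambda n).

Let X n (w : Omega) := M n w != 0%N.

Let error := estimation_error P X lambda h.

Lemma depends_upto_ones (Phi : (nat -> bool) -> Prop) L : depends_upto Phi L ->
  depends_upto (fun x : nat -> nat => Phi (fun i => x i != 0%N)) L.
Proof. by move=> H a b ab; apply: H => i iL; rewrite ab. Qed.

Lemma measurable_ones_event (Phi : (nat -> bool) -> Prop) L : depends_upto Phi L ->
  measurable [set w | Phi (X^~ w)].
Proof.
move=> /depends_upto_ones H.
exact: (@measurable_path_event _ _ M (fun x => Phi (fun i => x i != 0%N)) L).
Qed.

Lemma stop_depends n m : depends_upto (fun x => lambda n x = Some m) m.
Proof. by move=> a b ab; have [] := lambda_stop n ab. Qed.

(** The stopping time and the string observed by then determine the error, [theta] included, so it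
    is constant on each of the countably many events [W s]. *)
Lemma measurable_estimation_error n :
  measurable_fun [set: Omega] (error n).
Proof.
move=> _ Y _; rewrite setTI.
(* [observed x m] has [m.+1] entries, hence the predecessor of the size. *)
pose W (s : seq bool) := [set w | lambda n (X^~ w) = Some (size s).-1 /\
  observed (X^~ w) (size s).-1 = s].
have mW s : measurable (W s).
  apply: (@measurable_ones_event (fun x => lambda n x = Some (size s).-1 /\
    observed x (size s).-1 = s) (size s).-1).
  move=> x y xy [h1 h2]; split; first exact: (stop_depends xy).
  by rewrite -[RHS]h2; apply/observed_eq => i hi; rewrite xy.
have mN : measurable [set w | lambda n (X^~ w) = None].
  rewrite (_ : [set _ | _] = ~` \bigcup_m [set w | lambda n (X^~ w) = Some m]).
    apply: measurableC; apply: bigcupT_measurable => m.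
    exact: (measurable_ones_event (@stop_depends n m)).
  apply/seteqP; split=> w /=; first by move=> e [m _ /=]; rewrite e.
  by case E: (lambda n _) => [m|//] H; case: H; exists m.
have -> : error n @^-1` Y = (\bigcup_(s : seq bool)
    (if `[< exists2 w, W s w & Y (error n w) >] then W s else set0)) `|`
    ([set w | lambda n (X^~ w) = None] `&` (if `[< Y 0%E >] then setT else set0)).
  apply/seteqP; split=> w /=.
    move=> hY; case E: (lambda n (X^~ w)) => [m|].
      left; exists (observed (X^~ w) m) => //.
      have Ww : W (observed (X^~ w) m) w by rewrite /W /= size_map size_iota.
      by rewrite asboolT//; exists w.
    right; split=> //; rewrite asboolT//.
    by move: hY; rewrite /error /estimation_error E.
  case=> [[s _]|[E]].
    case: asboolP => // -[v [Wv1 Wv2] hY] [Ww1 Ww2].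
    move: hY; rewrite /error /estimation_error Wv1 Ww1 Wv2 Ww2.
    by rewrite /theta /discrete_cond_exp Wv2 Ww2.
  by case: asboolP => // hY _; rewrite /error /estimation_error E.
apply: measurableU.
  apply: countable_bigcupT_measurable; first exact: countableP.
  by move=> s; case: ifP.
by apply: measurableI => //; case: ifP.
Qed.

Lemma measurable_limsup_error : measurable [set w | (0 < limn_esup (error^~ w))%E].
Proof.
have := @measurable_realfun.measurable_fun_limn_esup _ _ R setT error
  (fun n => measurable_estimation_error n).
move=> /(_ measurableT [set y | (0 < y)%E]); rewrite setTI; apply.
rewrite (_ : [set y | _] = `]0%E, +oo%E]%classic); first exact: emeasurable_itv.
by apply/seteqP; split=> y /=; rewrite in_itv /= leey andbT.
Qed.

Lemma estimation_error_ge0 n w : (0 <= error n w)%E.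
Proof. by rewrite /error /estimation_error; case: lambda => // m; exact: abse_ge0. Qed.

Lemma ae_error_cvg0 : P [set w | (0 < limn_esup (error^~ w))%E] = 0%E ->
  {ae P, forall w, error^~ w @ \oo --> 0%E}.
Proof.
move=> P0; exists [set w | (0 < limn_esup (error^~ w))%E]; split=> //.
  exact: measurable_limsup_error.
move=> w /= hw; rewrite ltNge; apply/negP => le0; apply: hw.
by apply: limn_esup_le_cvg => // n; exact: estimation_error_ge0.
Qed.

End EstimationError.

(** * Frequency of the longest runs *)

(** The state after a zero is the length of the run that follows, so this counts zeros followed by
    exactly [N] ones. *)
Definition hits (N : nat) (x : nat -> nat) (k n : nat) : nat :=
  \sum_(m < n) ((x (k + m)%N == 0%N) && (x (k + m).+1 == N)).

Lemma hitsS N x k n :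
  hits N x k n.+1 = (((x k == 0%N) && (x k.+1 == N)) + hits N x k.+1 n)%N.
Proof.
rewrite /hits big_ord_recl addn0; congr addn; apply: eq_bigr => i _.
by rewrite lift0 addnS addSn.
Qed.

Lemma eq_hits N x y k n : (forall i, (i <= k + n)%N -> x i = y i) ->
  hits N x k n = hits N y k n.
Proof.
move=> xy; apply: eq_bigr => i _; have ni := ltn_ord i.
by rewrite !xy//; lia.
Qed.

(* The weight [2^h * rho^n] is a supermartingale bound: each step of the chain
   costs a factor [rho], and over one renewal cycle this loss is dominated by
   the factor [1 - T N / 2] that a possible hit gains. *)
Section FewHits.
Context {R : realType} {T : nat -> R} (hT : survival T).
Context {d : measure_display} {Omega : measurableType d} {P : probability Omega R}
  {M : nat -> {mfun Omega >-> nat}} (hM : sure_chain T P M).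
Variables (N : nat) (rho : R).
Hypotheses (T_gtN : forall k, (N < k)%N -> T k = 0).
Hypotheses (rho_gt0 : 0 < rho) (rho_le1 : rho <= 1).
Hypothesis rhoN : 1 - T N / 2 <= rho ^+ N.+1.

Lemma state_leN n w : (M n w <= N)%N.
Proof.
have [_ desc pos] := hM; elim: n => [|n IH]; rewrite leqNgt; apply/negP => lt.
  have := pos 0%N w; rewrite /path_weight big_ord0 mulr1 /init T_gtN//.
  by rewrite mul0r ltxx.
case E: (M n w) => [|i].
  have := pos n.+1 w; rewrite path_weightS E /= /gap_law !T_gtN// 1?ltnW//.
  by rewrite subrr mulr0 ltxx.
by have := desc _ _ _ E => Ei; move: lt IH; rewrite Ei E; lia.
Qed.

Let E a k n h : set Omega :=
  [set w | cylinder M a k w /\ (hits N (fun i => M i w) k n <= h)%N].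

Let mE a k n h : measurable (E a k n h).
Proof.
apply: (@measurable_path_event _ _ M (fun x => (forall i, (i <= k)%N -> x i = a i) /\
  (hits N x k n <= h)%N) (k + n)).
move=> x y xy [h1 h2]; split; last by rewrite -(eq_hits _ xy).
by move=> i ik; rewrite -xy ?h1//; lia.
Qed.

Let pr (A : set Omega) : R := fine (P A).

Let prE A : measurable A -> P A = (pr A)%:E.
Proof. by move=> mA; rewrite fineK// fin_num_measure. Qed.

Let le_pr A B : measurable A -> measurable B -> A `<=` B -> pr A <= pr B.
Proof.
by move=> mA mB AB; rewrite -lee_fin -!prE// le_measure ?inE.
Qed.

Let pr_cover A (F : nat -> set Omega) : measurable A ->
  (forall j, measurable (F j)) -> (forall w, A w -> exists2 j, (j <= N)%N & F j w) ->
  pr A <= \sum_(j < N.+1) pr (F j).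
Proof.
move=> mA mF AF; rewrite -lee_fin -prE//.
apply: (@le_trans _ _ (P (\big[setU/set0]_(j < N.+1) F j))).
  apply: le_measure; rewrite ?inE//; first exact: bigsetU_measurable.
  move=> w /AF[j jN hj]; rewrite -bigcup_mkord; by exists j.
apply: le_trans (@Boole_inequality _ _ _ P F N.+1 (fun i _ => mF i)) _.
rewrite (eq_bigr (fun j : 'I_N.+1 => (pr (F j))%:E)); last by move=> j _; exact: prE.
by rewrite sumEFin.
Qed.

Let next a k j i : nat := if (i <= k)%N then a i else j.

Let next_E a k w : cylinder M a k w -> cylinder M (next a k (M k.+1 w)) k.+1 w.
Proof.
move=> hc i; rewrite /next; case: (leqP i k) => ik; first by rewrite hc.
by move=> ik'; have -> : i = k.+1 by apply/eqP; rewrite eqn_leq ik ik'.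
Qed.

Let next_weight a k j : path_weight T (next a k j) k.+1 =
  path_weight T a k * transition (gap_law T) (a k) j.
Proof.
rewrite path_weightS (@eq_path_weight _ _ _ a) /next ?leqnn ?ltnn//.
by move=> i ->.
Qed.

(** The factor [rho ^+ a k] is an allowance for the forced countdown ahead, each step of which uses
    up one power. At a zero, every next run [j] is bounded through [rho ^+ N <= rho ^+ j]; the run
    [j = N] spends a hit and so counts half, whence the factor [1 - T N / 2], which is at most
    [rho ^+ N.+1]. *)
Lemma few_hits_cylinder n k a h :
  pr (E a k n h) * rho ^+ a k <= path_weight T a k * 2 ^+ h * rho ^+ n.
Proof.
have [cylM desc pos] := hM; have rho0 := ltW rho_gt0.
have wge b m := path_weight_ge0 b m hT.
elim: n k a h => [|n IH] k a h.
  have le : pr (E a k 0 h) <= path_weight T a k.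
    rewrite -lee_fin -prE// -cylM; apply: le_measure; rewrite ?inE//.
      exact: measurable_cylinder.
    by move=> w [].
  rewrite expr0 mulr1; apply: (@le_trans _ _ (path_weight T a k * 1)).
    apply: ler_pM => //; first exact: fine_ge0.
      exact: exprn_ge0.
    exact: exprn_ile1.
  by rewrite ler_wpM2l// exprn_ege1// ler1n.
case ak: (a k) => [|i]; last first.
  have le : pr (E a k n.+1 h) <= pr (E (next a k i) k.+1 n h).
    apply: le_pr => // w [hc]; rewrite hitsS hc// ak /= add0n => hh; split=> //.
    by have := next_E hc; rewrite (desc k w i)// hc.
  have := IH k.+1 (next a k i) h; rewrite next_weight {2}/next ltnn ak /= eqxx mulr1.
  move=> hi; rewrite exprS [rho ^+ n.+1]exprS.
  have := ler_wpM2r (exprn_ge0 i rho0) le => /le_trans/(_ hi).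
  by move=> /(ler_wpM2l rho0); rewrite mulrCA [X in _ <= X]mulrCA.
rewrite expr0 mulr1.
pose c j : R := if j == N then 2 ^+ h / 2 else 2 ^+ h.
pose F j := if j == N then (if h is h'.+1 then E (next a k j) k.+1 n h' else set0)
  else E (next a k j) k.+1 n h.
have mF j : measurable (F j).
  by rewrite /F; case: ifP => // _; case: (h).
have cov : pr (E a k n.+1 h) <= \sum_(j < N.+1) pr (F j).
  apply: pr_cover => // w [hc]; rewrite hitsS hc// ak eqxx /= => hh.
  exists (M k.+1 w); first exact: state_leN.
  rewrite /F; case: eqP hh => [e|ne] hh; last by split=> //; exact: next_E.
  by case: (h) hh => // h'; rewrite add1n ltnS => hh; split=> //; exact: next_E.
have bF j : (j <= N)%N -> pr (F j) * rho ^+ N <=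
    path_weight T a k * rho ^+ n * (gap_law T j * c j).
  move=> jN; apply: (@le_trans _ _ (pr (F j) * rho ^+ j)).
    apply: ler_wpM2l; first exact: fine_ge0.
    by apply: ler_wiXn2l.
  have hj h' := IH k.+1 (next a k j) h'; rewrite {2}/next ltnn next_weight ak /= in hj.
  rewrite /F /c; case: ifP => _; last first.
    by apply: le_trans (hj h) _; rewrite le_eqVlt; apply/orP; left; apply/eqP; ring.
  case: (h) => [|h'].
    rewrite /pr measure0 mul0r; apply: mulr_ge0.
      by apply: mulr_ge0 => //; exact: exprn_ge0.
    by apply: mulr_ge0; [exact: gap_law_ge0|rewrite expr0 mul1r invr_ge0].
  by apply: le_trans (hj h') _; rewrite le_eqVlt exprS; apply/orP; left; apply/eqP; field.
have s1 : \sum_(j < N.+1) gap_law T j * c j = 2 ^+ h * (1 - T N / 2).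
  have := sum_gap_law N.+1 hT; rewrite T_gtN// subr0.
  rewrite !big_ord_recr /= => e; rewrite /c eqxx.
  rewrite (eq_bigr (fun i : 'I_N => 2 ^+ h * gap_law T i)).
    rewrite -mulr_sumr; have gN : gap_law T N = T N by rewrite /gap_law (T_gtN (ltnSn N)) subr0.
    rewrite gN in e *; rewrite (_ : \sum_(i < N) _ = 1 - T N); last by lra.
    by field.
  by move=> i _; rewrite ltn_eqF// mulrC.
have rN : 0 < rho ^+ N by exact: exprn_gt0.
rewrite -(ler_pM2r rN); apply: le_trans (ler_wpM2r (ltW rN) cov) _.
rewrite mulr_suml; apply: (@le_trans _ _
  (\sum_(j < N.+1) path_weight T a k * rho ^+ n * (gap_law T j * c j))).
  by apply: ler_sum => j _; apply: bF; rewrite -ltnS.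
rewrite -mulr_sumr s1.
have -> : path_weight T a k * 2 ^+ h * rho ^+ n.+1 * rho ^+ N =
  path_weight T a k * rho ^+ n * (2 ^+ h * rho ^+ N.+1) by rewrite !exprS; ring.
apply: ler_wpM2l; first by apply: mulr_ge0 => //; exact: exprn_ge0.
by apply: ler_wpM2l => //; exact: exprn_ge0.
Qed.

Lemma few_hits n h :
  (P [set w | (hits N (fun i => M i w) 0 n <= h)%N] * (rho ^+ N)%:E <=
    (2 ^+ h * rho ^+ n)%:E)%E.
Proof.
have rho0 := ltW rho_gt0; set A := [set w | _].
have mA : measurable A.
  apply: (@measurable_path_event _ _ M (fun x => (hits N x 0 n <= h)%N) n).
  by move=> x y xy; rewrite (@eq_hits _ x y 0 n).
have cov : pr A <= \sum_(j < N.+1) pr (E (fun=> j) 0 n h).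
  apply: (pr_cover mA (fun j => mE (fun=> j) 0 n h)) => w hw.
  exists (M 0%N w); first exact: state_leN.
  by split=> // i; rewrite leqn0 => /eqP ->.
rewrite prE// -EFinM lee_fin.
apply: le_trans (ler_wpM2r (exprn_ge0 N rho0) cov) _; rewrite mulr_suml.
apply: (@le_trans _ _ (\sum_(j < N.+1) init T j * (2 ^+ h * rho ^+ n))).
  apply: ler_sum => j _; apply: (@le_trans _ _ (pr (E (fun=> val j) 0 n h) * rho ^+ j)).
    apply: ler_wpM2l; first exact: fine_ge0.
    by apply: ler_wiXn2l => //; rewrite -ltnS.
  have := few_hits_cylinder n 0 (fun=> val j) h.
  by rewrite /path_weight big_ord0 mulr1 -mulrA.
rewrite -mulr_suml ler_piMl ?mulr_ge0 ?exprn_ge0//.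
exact: cdf_le1 (cdf_init hT).
Qed.

End FewHits.

(** * One stage of the construction *)

Lemma bernoulli_le (R : realType) (x : R) n : 0 <= x <= 1 ->
  1 - n%:R * x <= (1 - x) ^+ n.
Proof.
move=> /andP[x0 x1]; elim: n => [|n IH]; first by rewrite mul0r subr0.
rewrite exprS; apply: (@le_trans _ _ ((1 - x) * (1 - n%:R * x))); last first.
  by rewrite ler_wpM2l// subr_ge0.
have : 0 <= n%:R * x * x by rewrite !mulr_ge0.
by rewrite -natr1; lra.
Qed.

Lemma eventually_lt (R : realType) (u : nat -> \bar R) (l y : \bar R) :
  u @ \oo --> l -> (l < y)%E -> exists s, forall n, (s <= n)%N -> (u n < y)%E.
Proof.
move=> hu ly; have : nbhs l [set x | (x < y)%E].
  by apply: open_nbhs_nbhs; split=> //; exact: open_ereal_lt_ereal.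
by move=> /hu [s _ hs]; exists s.
Qed.

(** Pigeonhole among the times [0] to [L]: the ends [m + N] of the runs that hit, against the values
    of [v] from [n0] on. *)
Lemma overlap (N K n0 L : nat) (hit : nat -> bool) (v : nat -> nat) :
  (forall m, (m < K)%N -> (m + N <= L)%N) ->
  (forall n, (n <= K)%N -> (v n <= L)%N) ->
  (forall n n', (n < n' <= K)%N -> (v n < v n')%N) -> (n0 <= K)%N ->
  (L.+1 < \sum_(m < K) hit m + (K - n0).+1)%N ->
  exists m n, [/\ (m < K)%N, hit m, (n0 <= n <= K)%N & v n = (m + N)%N].
Proof.
move=> hL vL vmono n0K lt.
pose A := [set @inord L (m + N) | m : 'I_K & hit m].
pose B := [set @inord L (v (n0 + k)%N) | k : 'I_(K - n0).+1].
have vL' (k : 'I_(K - n0).+1) : (v (n0 + k) < L.+1)%N.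
  by have := ltn_ord k; rewrite !ltnS => hk; apply: vL; lia.
have cA : #|A| = (\sum_(m < K) hit m)%N.
  rewrite card_in_imset.
    by rewrite -sum1dep_card big_mkcond /=; apply: eq_bigr => m _; case: (hit m).
  move=> a b _ _ /(congr1 val); rewrite /= !inordK ?ltnS ?hL// => /addIn e.
  exact: val_inj.
have cB : #|B| = (K - n0).+1.
  rewrite card_imset ?card_ord// => a b /(congr1 val); rewrite /= !inordK// => e.
  apply: val_inj; apply/eqP; rewrite /= eqn_leq; apply/andP.
  by split; rewrite leqNgt; apply/negP => lt';
    have := ltn_ord a; have := ltn_ord b; rewrite !ltnS => hb ha;
    [have := vmono (n0 + b)%N (n0 + a)%N|have := vmono (n0 + a)%N (n0 + b)%N];
    rewrite e ltnn => H; suff : false by []; apply: H; lia.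
have [AB|[x]] := set_0Vmem (A :&: B).
  have := cardsUI A B; rewrite AB cards0 addn0 cA cB => e.
  by have := max_card [in A :|: B]; rewrite e card_ord leqNgt lt.
rewrite inE => /andP[/imsetP[m]]; rewrite inE => hm -> /imsetP[k _].
move=> /(congr1 val) /=; rewrite !inordK ?vL' ?ltnS ?hL// => e.
exists m, (n0 + k)%N; split=> //.
by have := ltn_ord k; rewrite ltnS => hk; lia.
Qed.

Lemma stopping_times_gap (lambda : nat -> (nat -> bool) -> option nat) x n m k :
  strictly_increasing_times lambda -> lambda n x = Some m -> (k <= n)%N ->
  exists2 m', lambda (n - k)%N x = Some m' & (m' + k <= m)%N.
Proof.
move=> incr hn; elim: k => [|k IH] kn; first by exists m; rewrite ?subn0 ?addn0.
have [m' hm' lem] := IH (ltnW kn).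
have := incr (n - k.+1)%N x; rewrite subnSK// hm'.
case: (lambda (n - k.+1)%N x) => [m''|//] lt; exists m'' => //; lia.
Qed.

(** The threshold [s + n1] adds the delay [s] that the rate allows to the [n1] indices discarded at
    the start. *)
Lemma stopping_time_hit (lambda : nat -> (nat -> bool) -> option nat) x
    (N K s n1 m0 : nat) (hit : nat -> bool) :
  strictly_increasing_times lambda -> lambda (K * s)%N x = Some m0 ->
  (m0 <= K.+1 * s)%N -> (n1 <= s)%N -> (N <= s)%N -> (0 < K)%N ->
  (s + n1 < \sum_(m < K * s) hit m)%N ->
  exists m n, [/\ (m < K * s)%N, hit m, (n1 <= n)%N & lambda n x = Some (m + N)%N].
Proof.
move=> incr hl0 hm0 n1s Ns K0 hw.
have sK : (s <= K * s)%N by rewrite leq_pmull.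
rewrite mulSn in hm0; set A := (K * s)%N in hl0 hm0 hw sK *.
pose v n := odflt 0%N (lambda n x).
have vS n : (n <= A)%N -> lambda n x = Some (v n) /\ (v n + (A - n) <= m0)%N.
  move=> hn; have [m' e le] := stopping_times_gap incr hl0 (leq_subr n A).
  by rewrite subKn// in e; rewrite /v e.
have vmono n n' : (n < n' <= A)%N -> (v n < v n')%N.
  move=> /andP[nn' n'K]; have [e _] := vS _ n'K.
  have [m' e' le] := stopping_times_gap incr e (leq_subr n n').
  rewrite (subKn (ltnW nn')) in e'; have -> : v n = m' by rewrite /v e'.
  by apply: leq_trans le; rewrite -addn1 leq_add2l subn_gt0.
have [|n nA|//|||m [n [mA hm /andP[n1n nA] vn]]] := @overlap N A n1 (s + A) hit v.
- by move=> m hm; rewrite addnC leq_add// ltnW.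
- by have [_ h] := vS n nA; apply: leq_trans hm0; apply: leq_trans h; rewrite leq_addr.
- exact: leq_trans sK.
- by move: hw n1s sK; clear; lia.
by exists m, n; split=> //; rewrite -vn; have [] := vS _ nA.
Qed.

(* Under the law of a renewal process whose runs of ones never exceed [N], the
   estimate is asymptotically forced down to [theta = 0] after a run of [N] ones. *)
Definition low_estimate (R : realType) (lambda : nat -> (nat -> bool) -> option nat)
    (h : nat -> seq bool -> R) (i N L : nat) (x : nat -> bool) : Prop :=
  exists n z, [/\ (i <= n)%N, (z + N <= L)%N, lambda n x = Some (z + N)%N,
    x z = false & (forall j, (z < j <= z + N)%N -> x j) /\
    `|h n (observed x (z + N))| < 1 / 8].

Lemma low_estimate_depends (R : realType)
    (lambda : nat -> (nat -> bool) -> option nat) (h : nat -> seq bool -> R) i N L :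
  (forall n, stopping_time (lambda n)) -> depends_upto (low_estimate lambda h i N L) L.
Proof.
move=> lambda_stop x y xy [n [z [h1 h2 h3 h4 [h5 h6]]]].
have xy' k : (k <= z + N)%N -> x k = y k by move=> hk; apply: xy; lia.
exists n, z; split=> //; first by apply/(lambda_stop n _ _ _ xy').
  by rewrite -xy'// leq_addr.
split; first by move=> j /andP[zj jN]; rewrite -xy'//; apply: h5; rewrite zj.
by rewrite (_ : observed y _ = observed x (z + N)%N)//; apply/observed_eq => k hk; rewrite xy'.
Qed.

Section Stage.
Context {R : realType} {T : nat -> R} (hT : survival T).
Context {d : measure_display} {Omega : measurableType d} {P : probability Omega R}
  {M : nat -> {mfun Omega >-> nat}} (hM : sure_chain T P M).
Variables (lambda : nat -> (nat -> bool) -> option nat) (h : nat -> seq bool -> R).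
Hypothesis lambda_stop : forall n, stopping_time (lambda n).
Hypothesis lambda_incr : strictly_increasing_times lambda.
Let X n (w : Omega) := M n w != 0%N.
Let error := estimation_error P X lambda h.
Hypothesis rate : {ae P, forall w,
  (fun n => ext_time R (lambda n (X^~ w)) * (n%:R^-1)%R%:E)%E @ \oo --> 1%E}.
Hypothesis error0 : {ae P, forall w, error^~ w @ \oo --> 0%E}.
Variable N : nat.
Hypotheses (T_gtN : forall k, (N < k)%N -> T k = 0) (T_gt0 : 0 < T N).

(** The rate is recorded only along multiples of [K], where the factor [1 + 1 / K] becomes an
    integer bound. *)
Let good (K s : nat) : set Omega :=
  [set w | forall n, (s <= n)%N ->
    (exists2 m, (m <= K.+1 * n)%N & lambda (K * n) (X^~ w) = Some m) /\
    (error n w < (1 / 8)%:E)%E].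

Lemma measurable_good K s : measurable (good K s).
Proof.
rewrite (_ : good K s = \bigcap_(n in [set n | (s <= n)%N])
   ([set w | exists2 m, (m <= K.+1 * n)%N & lambda (K * n) (X^~ w) = Some m] `&`
    [set w | (error n w < (1 / 8)%:E)%E])); last first.
  by apply/seteqP; split=> w H n sn; have := H n sn.
apply: bigcap_measurableType => n _; apply: measurableI.
  apply: (@measurable_ones_event _ _ M
    (fun x => exists2 m, (m <= K.+1 * n)%N & lambda (K * n) x = Some m) (K.+1 * n)).
  move=> x y xy [m hm hl]; exists m => //.
  have xy' i : (i <= m)%N -> x i = y i by move=> im; rewrite xy// (leq_trans im).
  by have [H _] := lambda_stop (K * n)%N xy'; exact: H.
have := @measurable_estimation_error R d Omega P M lambda h lambda_stop n measurableT
  [set y | (y < (1 / 8)%:E)%E].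
rewrite setTI; apply; rewrite (_ : [set y | _] = `[-oo%E, (1 / 8)%:E[%classic).
  exact: emeasurable_itv.
by apply/seteqP; split=> y /=; rewrite in_itv /= leNye.
Qed.

Lemma eventually_good K : (0 < K)%N -> {ae P, forall w, exists s, good K s w}.
Proof.
move=> K0; apply: filterS2 rate error0 => w hr he.
have Kr : 0 < K%:R :> R by rewrite ltr0n.
have [s1 hs1] : exists s1, forall n, (s1 <= n)%N ->
    (ext_time R (lambda n (X^~ w)) * (n%:R^-1)%R%:E < (1 + K%:R^-1)%:E)%E.
  by apply: (eventually_lt hr); rewrite lte_fin ltrDl invr_gt0.
have [s2 hs2] : exists s2, forall n, (s2 <= n)%N -> (error n w < (1 / 8)%:E)%E.
  by apply: (eventually_lt he); rewrite lte_fin divr_gt0.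
exists (maxn (maxn s1 s2) 1) => n; rewrite !geq_max => /andP[/andP[n1 n2] n0].
split; last exact: hs2.
have Kn : (0 < K * n)%N by rewrite muln_gt0 K0.
have := hs1 (K * n)%N (leq_trans n1 (leq_pmull _ K0)) => /=.
have Knr : 0 < (K * n)%:R :> R by rewrite ltr0n.
case: (lambda _ _) => [m|] /=; last by rewrite gt0_mulye ?lte_fin ?invr_gt0.
rewrite lte_fin ltr_pdivrMr// mulrDl mul1r natrM mulKf ?lt0r_neq0// -natrM -natrD ltr_nat.
by move=> lt; exists m => //; rewrite mulSn addnC ltnW.
Qed.

Lemma good_prob K : (0 < K)%N -> exists s, ((3 / 4)%:E < P (good K s))%E.
Proof.
move=> K0.
have mU : measurable (\bigcup_s good K s).
  by apply: bigcupT_measurable => s; exact: measurable_good.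
have P1 : P (\bigcup_s good K s) = 1%E.
  have : P (~` \bigcup_s good K s) = 0%E.
    apply: measure_negligible; first exact: measurableC.
    apply: negligibleS (eventually_good K0) => w /= hw [s hs].
    by apply: hw; exists s.
  rewrite probability_setC// => e.
  have : P (\bigcup_s good K s) = (1 - (1 - P (\bigcup_s good K s)))%E.
    have /fineK <- : P (\bigcup_s good K s) \is a fin_num by exact: fin_num_measure.
    by rewrite -!EFinB; congr (_%:E); ring.
  by rewrite e sube0.
have cv : P (good K s) @[s --> \oo] --> P (\bigcup_s good K s).
  apply: nondecreasing_cvg_mu => //; first by move=> s; exact: measurable_good.
  move=> s s' ss'; apply/subsetPset => w H n hn; apply: H.
  exact: leq_trans ss' hn.
rewrite P1 in cv.
have : (- P (good K s))%E @[s --> \oo] --> (- 1)%E by exact: cvgeN.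
move=> /eventually_lt H; have [|s /(_ s (leqnn s))] := H (- (3 / 4)%:E)%E.
  by rewrite -EFinN lte_fin; lra.
by rewrite lteN2 => hs; exists s.
Qed.

Lemma low_estimate_prob i : exists L,
  ((1 / 2)%:E <= P [set w | low_estimate lambda h i N L (X^~ w)])%E.
Proof.
have [T0 dT Tge _] := hT.
have TN1 : T N <= 1.
  rewrite -T0; elim: (N) => // k IH; exact: le_trans (dT k) IH.
(* Chosen so that the Bernoulli inequality gives [1 - T N / 2 <= rho ^+ N.+1]. *)
pose y : R := T N / 2 / N.+1%:R.
have n0 : 0 < N.+1%:R :> R by rewrite ltr0n.
have y0 : 0 < y by rewrite !divr_gt0.
have y1 : y <= 1 / 2.
  rewrite /y ler_pdivrMr// ; have : 1 <= N.+1%:R :> R by rewrite ler1n.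
  by lra.
pose rho := 1 - y.
have rho0 : 0 < rho by rewrite /rho; lra.
have rho1 : rho < 1 by rewrite /rho; lra.
have rhoN : 1 - T N / 2 <= rho ^+ N.+1.
  have -> : T N / 2 = N.+1%:R * y by rewrite [RHS]mulrC /y divfK// lt0r_neq0.
  by apply: bernoulli_le; lra.
have rho_abs : `|rho| < 1 by rewrite ger0_norm// ltW.
(* With this [K], the bound [2 ^+ (s + n1) * rho ^+ (K * s)] coming from [few_hits] is at most
   [2 ^+ n1 / 2 ^+ s], which tends to [0] as [s] grows. *)
have [K K0 hK] : exists2 K, (0 < K)%N & 2 * rho ^+ K <= 1 / 2.
  have : \forall n \near \oo, rho ^+ n < 1 / 4.
    by apply: (cvgr_lt 0); [exact: cvg_expr|rewrite divr_gt0].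
  move=> [n _ hn]; exists n.+1 => //.
  by have := hn n.+1 (leqnSn n) => /=; lra.
have [s0 hs0] := good_prob K0.
(* Below [s0] the event [good] controls nothing; below [i] indices are discarded so that later
   stages produce later errors. *)
pose n1 := maxn s0 i.
have [s [s_n1 s_N hs]] : exists s, [/\ (n1 <= s)%N, (N <= s)%N &
    2 ^+ (s + n1) * rho ^+ (K * s) <= rho ^+ N * (1 / 4)].
  have e0 : 0 < rho ^+ N * (1 / 4) / 2 ^+ n1 by rewrite !divr_gt0 ?mulr_gt0 ?exprn_gt0.
  have : \forall n \near \oo, (1 / 2 : R) ^+ n < rho ^+ N * (1 / 4) / 2 ^+ n1.
    apply: (cvgr_lt 0) => //; apply: cvg_expr.
    by rewrite ger0_norm//; lra.
  move=> [n _ hn]; exists (maxn (maxn n1 N) n); set s := maxn _ _.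
  have n1s : (n1 <= s)%N := leq_trans (leq_maxl n1 N) (leq_maxl _ n).
  have Ns : (N <= s)%N := leq_trans (leq_maxr n1 N) (leq_maxl _ n).
  split=> //.
  have := hn s (leq_maxr _ _) => /= hlt.
  rewrite exprD exprM mulrAC -[2 ^+ s * _]exprMn_comm; last exact: mulrC.
  rewrite -ler_pdivlMr ?exprn_gt0//; apply: le_trans (ltW hlt).
  apply: lerXn2r => //; rewrite nnegrE ?mulr_ge0 ?exprn_ge0// ?ltW//.
exists (K.+1 * s)%N; set L := (K.+1 * s)%N.
set B := [set w | (hits N (fun i => M i w) 0 (K * s) <= s + n1)%N].
set A := [set w | _].
have mB : measurable B.
  apply: (@measurable_path_event _ _ M (fun x => (hits N x 0 (K * s) <= s + n1)%N) (K * s)).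
  by move=> x y' xy; rewrite (@eq_hits _ x y' 0 (K * s)).
have mA : measurable A.
  apply: (@measurable_ones_event _ _ M (low_estimate lambda h i N L) L).
  exact: low_estimate_depends.
have PB : (P B <= (1 / 4)%:E)%E.
  have := few_hits hT hM T_gtN rho0 (ltW rho1) rhoN (K * s) (s + n1).
  rewrite -/B; have /fineK <- : P B \is a fin_num by exact: fin_num_measure.
  rewrite -EFinM !lee_fin => hB; rewrite -(ler_pM2r (exprn_gt0 N rho0)).
  by apply: le_trans hB _; apply: le_trans hs _; rewrite mulrC.
(* Probabilities above [3/4] for [good] and at most [1/4] for [B] leave [1/2] for [A]. *)
suff sub : good K s0 `<=` A `|` B.
  have mG := measurable_good K s0.
  have : (P (good K s0) <= P A + P B)%E.
    apply: (@le_trans _ _ (P (A `|` B))); last exact: measureU2.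
    by apply: le_measure; rewrite ?inE//; exact: measurableU.
  move: hs0 PB.
  have /fineK <- : P B \is a fin_num by exact: fin_num_measure.
  have /fineK <- : P A \is a fin_num by exact: fin_num_measure.
  have /fineK <- : P (good K s0) \is a fin_num by exact: fin_num_measure.
  by rewrite -EFinD !lee_fin lte_fin; lra.
move=> w hG; case: (leqP (hits N (fun i => M i w) 0 (K * s)) (s + n1)) => hw.
  by right.
left; have s0s : (s0 <= s)%N by rewrite (leq_trans _ s_n1)// leq_maxl.
have [[m0 hm0 hl0] _] := hG s s0s.
have [m [n [mK hm n1n ln]]] := @stopping_time_hit lambda (X^~ w) N K s n1 m0
  (fun m => (M m w == 0%N) && (M m.+1 w == N)) lambda_incr hl0 hm0 s_n1 s_N K0 hw.
have /andP[/eqP Mm /eqP MN] := hm.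
have ones j : (m < j <= m + N)%N -> M j w != 0%N by exact: (sure_chain_ones hM).
exists n, m; split=> //.
- by rewrite (leq_trans _ n1n)// leq_maxr.
- by rewrite /L mulSn addnC leq_add// ltnW.
- by rewrite /X Mm.
split=> //.
have [_] := hG n (leq_trans (leq_maxl _ _) n1n).
rewrite /error /estimation_error ln (theta_eq0 hM Mm ones T_gtN).
by rewrite sube0 abse_EFin lte_fin.
Qed.

End Stage.

(** * The limit law *)

Section LimitLaw.
Context {R : realType}.
Implicit Types (T : nat -> R).

Definition finite_survival (N : nat) T : Prop :=
  [/\ survival T, forall k, (N < k)%N -> T k = 0 & 0 < T N].

Lemma survival_finite N T : T 0 = 1 -> (forall k, T k.+1 <= T k) ->
  (forall k, (N < k)%N -> T k = 0) -> survival T.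
Proof.
move=> T0 dT TN.
have mono : {homo T : m n / (m <= n)%N >-> n <= m} by apply/nonincreasing_seqP.
have Tge k : 0 <= T k by rewrite -(TN (k + N.+1)%N) ?mono// ?leq_addr// addnS ltnS leq_addl.
split=> //; exists (\sum_(k < N.+1) T k) => n.
apply: (@le_trans _ _ (\sum_(k < n + N.+1) T k)).
  by rewrite big_split_ord /= lerDl sumr_ge0.
rewrite addnC big_split_ord /= [X in _ + X]big1 ?addr0// => k _.
by rewrite TN// ltn_addr.
Qed.

Definition extend (N N' : nat) T (k : nat) : R :=
  if (k <= N)%N then T k else if (k <= N')%N then T N / N'%:R else 0.

Lemma finite_survival_extend N N' T : (N < N')%N ->
  finite_survival N T -> finite_survival N' (extend N N' T).
Proof.
move=> NN' [[T0 dT Tge _] TN TNgt0].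
have N'0 : 1 <= N'%:R :> R by rewrite ler1n (leq_trans _ NN').
have q0 : 0 <= T N / N'%:R by rewrite divr_ge0.
have q1 : T N / N'%:R <= T N.
  by rewrite ler_pdivrMr ?(lt_le_trans ltr01)// ler_peMr.
have N'k k : (N' < k)%N -> extend N N' T k = 0.
  by move=> h; rewrite /extend (leqNgt k N) (ltn_trans NN' h) /= (leqNgt k N') h.
split=> //; last first.
  by rewrite /extend leqNgt NN' leqnn /= divr_gt0// (lt_le_trans ltr01).
apply: survival_finite N'k => // k; rewrite /extend.
case: (ltngtP k N) => [kN|kN|->].
- exact: dT.
- by case: (leqP k.+1 N') => h; [rewrite ltnW|case: ifP].
- by rewrite ?ltnn ?leqnn NN'.
Qed.

Variable block : nat -> nat * (nat -> R) -> nat.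

Fixpoint stage (i : nat) : nat * (nat -> R) :=
  if i is i'.+1 then
    let N' := block i' (stage i') in (N', extend (stage i').1 N' (stage i').2)
  else (0%N, fun k => (k == 0%N)%:R).

(** The summand [4] makes [V] shrink at least fourfold per stage; [2 * s.1] puts at least half of
    the new length beyond the old one. *)
Hypothesis block_gt : forall i s, (2 * s.1 + 4 <= block i s)%N.

Let N i := (stage i).1.
Let V i := (stage i).2 (N i).

(** The diagonal is the pointwise limit: [k <= N k], and values up to [N k] no longer change after
    stage [k]. *)
Definition limit_survival (k : nat) : R := (stage k).2 k.

Lemma stage_gap i : (2 * N i + 4 <= N i.+1)%N.
Proof. exact: block_gt. Qed.

Lemma stage_ge i : (i <= N i)%N.
Proof. by elim: i => // i IH; have := stage_gap i; lia. Qed.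

Lemma stage_finite i : finite_survival (N i) (stage i).2.
Proof.
elim: i => [|i IH].
  split=> [||]; rewrite /N /= ?ltr01//; last by case.
  by apply: (@survival_finite 0) => //; case.
have lt : (N i < N i.+1)%N by have := stage_gap i; lia.
exact: finite_survival_extend lt IH.
Qed.

Lemma stage_stable i j k : (i <= j)%N -> (k <= N i)%N -> (stage j).2 k = (stage i).2 k.
Proof.
move=> + kN; elim: j => [|j IH]; first by rewrite leqn0 => /eqP ->.
rewrite leq_eqVlt => /orP[/eqP -> //|]; rewrite ltnS => ij; rewrite -IH//.
rewrite /= /extend ifT//; apply: leq_trans kN _.
elim: j ij {IH} => [|j IH]; first by rewrite leqn0 => /eqP ->.
rewrite leq_eqVlt => /orP[/eqP -> //|]; rewrite ltnS => /IH h.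
have g : (N j <= N j.+1)%N by have := stage_gap j; lia.
exact: leq_trans h g.
Qed.

Lemma limit_stage i k : (k <= N i)%N -> limit_survival k = (stage i).2 k.
Proof.
move=> kN; case: (leqP i k) => ik; first exact: stage_stable.
by rewrite /limit_survival -(stage_stable (ltnW ik) (stage_ge k)).
Qed.

Lemma limit_block i k : (N i < k <= N i.+1)%N -> limit_survival k = V i / (N i.+1)%:R.
Proof.
move=> /andP[k1 k2]; rewrite (limit_stage k2) /= /extend leqNgt -/(N i) k1 /=.
by rewrite -[block _ _]/(N i.+1) k2.
Qed.

Lemma V_gt0 i : 0 < V i.
Proof. by have [_ _] := stage_finite i. Qed.

Lemma VS i : V i.+1 = V i / (N i.+1)%:R.
Proof.
rewrite -(@limit_block i (N i.+1)); first by rewrite (limit_stage (leqnn _)).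
by have := stage_gap i; rewrite leqnn andbT; lia.
Qed.

Lemma VS_le i : 4 * V i.+1 <= V i.
Proof.
have h : (4 <= N i.+1)%N by have := stage_gap i; lia.
have Np : 0 < (N i.+1)%:R :> R by rewrite ltr0n; lia.
by rewrite VS mulrA ler_pdivrMr// mulrC ler_wpM2l ?(ltW (V_gt0 i))// ler_nat.
Qed.

Lemma sum_limit_le n : \sum_(k < n) limit_survival k <= 3.
Proof.
have ge0 k : 0 <= limit_survival k.
  by have [[_ _ h _] _ _] := stage_finite k; exact: h.
(* The reserve [2 * V i] pays for all later stages: the next one adds at most [V i], and
   [2 * V i.+1 <= V i]. *)
have S i : \sum_(k < (N i).+1) limit_survival k <= 3 - 2 * V i.
  elim: i => [|i IH].
    by rewrite big_ord1 /limit_survival /V /N /= ; lra.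
  have NN : (N i <= N i.+1)%N by have := stage_gap i; lia.
  have e : ((N i.+1).+1 = (N i).+1 + (N i.+1 - N i))%N by lia.
  rewrite e big_split_ord /=.
  rewrite [X in _ + X](eq_bigr (fun=> V i / (N i.+1)%:R)); last first.
    by move=> k _; apply: limit_block; have := ltn_ord k; lia.
  rewrite sumr_const card_ord -mulr_natr.
  have Np : 0 < (N i.+1)%:R :> R by rewrite ltr0n; have := stage_gap i; lia.
  have : V i / (N i.+1)%:R * (N i.+1 - N i)%:R <= V i.
    rewrite -mulrA ler_piMr ?(ltW (V_gt0 i))// mulrC ler_pdivrMr// mul1r ler_nat.
    exact: leq_subr.
  by have := VS_le i; have := V_gt0 i.+1; move: IH; lra.
have := S n; have := V_gt0 n; have : \sum_(k < n) limit_survival k <=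
    \sum_(k < (N n).+1) limit_survival k.
  have e : ((N n).+1 = n + ((N n).+1 - n))%N by have := stage_ge n; lia.
  by rewrite e big_split_ord /= lerDl sumr_ge0.
by lra.
Qed.

Lemma limit_survival_survival : survival limit_survival.
Proof.
split; first by rewrite /limit_survival.
- move=> k; have [[_ dT _ _] _ _] := stage_finite k.+1.
  have h := stage_ge k.+1; rewrite (limit_stage h) (limit_stage (ltnW h)).
  exact: dT.
- by move=> k; have [[_ _ h _] _ _] := stage_finite k; exact: h.
- by exists 3; exact: sum_limit_le.
Qed.

(** At least half of [N i.+1] ones remain, and later stages leave at least half of the mass
    [V i.+1 = V i / N i.+1] on runs of this length; the length cancels. *)
Lemma limit_theta_ge i : 1 / 4 <=
  (N i.+1 - N i)%:R * gap_law limit_survival (N i.+1) / limit_survival (N i).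
Proof.
have g := stage_gap i; have Np : 0 < (N i.+1)%:R :> R by rewrite ltr0n; lia.
have Vp := V_gt0 i.
have -> : limit_survival (N i) = V i by exact: limit_stage.
have e : gap_law limit_survival (N i.+1) = V i.+1 - V i.+2.
  have g' := stage_gap i.+1; rewrite /gap_law (limit_stage (leqnn _)) (VS i.+1).
  by rewrite (@limit_block i.+1 (N i.+1).+1)//; lia.
rewrite e ler_pdivlMr//.
have h1 : V i.+1 / 2 <= V i.+1 - V i.+2 by have := VS_le i.+1; have := V_gt0 i.+2; lra.
have h2 : (N i.+1)%:R / 2 <= (N i.+1 - N i)%:R :> R.
  rewrite ler_pdivrMr// -natrM ler_nat; lia.
apply: (@le_trans _ _ ((N i.+1)%:R / 2 * (V i.+1 / 2))).
  have -> : (N i.+1)%:R / 2 * (V i.+1 / 2) = (N i.+1)%:R * V i.+1 / 4 by field.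
  by rewrite VS mulrCA divff ?lt0r_neq0// mulr1; lra.
apply: (ler_pM _ _ h2 h1); first by rewrite divr_ge0.
by rewrite divr_ge0// ltW// V_gt0.
Qed.

(** The initial laws cost [1/3], as both totals are at least [1] and the limit total is at most [3].
    Only the gap [N i] loses probability, by the factor [1 - 1 / N i.+1], and over at most [L] draws
    this costs [1/2]. *)
Lemma limit_weight_ge i L a : (2 * L <= N i.+1)%N ->
  1 / 6 * path_weight (stage i).2 a L <= path_weight limit_survival a L.
Proof.
move=> LN; have g := stage_gap i.
have Np : 0 < (N i.+1)%:R :> R by rewrite ltr0n; lia.
have hS := limit_survival_survival; have [hT TN _] := stage_finite i.
have [_ _ Tge _] := hT; have [_ _ Sge _] := hS.
pose x : R := (N i.+1)%:R^-1.
have x0 : 0 <= x by rewrite invr_ge0 ltW.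
have x1 : x <= 1 by rewrite invf_le1// ler1n; lia.
have r0 : 0 <= 1 - x by lra.
have hgap k : (1 - x) * gap_law (stage i).2 k <= gap_law limit_survival k.
  case: (ltngtP k (N i)) => [kN|kN|->].
  - rewrite /gap_law !(@limit_stage i)// 1?ltnW//.
    by apply: ler_piMl; [exact: gap_law_ge0|lra].
  - have -> : gap_law (stage i).2 k = 0 by rewrite /gap_law (TN k kN) (TN k.+1 (leqW kN)) subrr.
    by rewrite mulr0; exact: gap_law_ge0.
  rewrite /gap_law (TN (N i).+1)// subr0 (@limit_stage i)// (@limit_block i); last by lia.
  by rewrite mulrBl mul1r -/(V i) mulrC [_ * x]mulrC; rewrite mulrC.
have htr s j : (1 - x) * transition (gap_law (stage i).2) s j <=
    transition (gap_law limit_survival) s j.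
  by case: s => [|s] /=; [exact: hgap|apply: ler_piMl => //; lra].
have hinit k : 1 / 3 * init (stage i).2 k <= init limit_survival k.
  have le : (stage i).2 k <= limit_survival k.
    case: (leqP k (N i)) => kN; first by rewrite (@limit_stage i).
    by rewrite TN.
  have t1 := total_ge1 hT; have t3 := total_le hS sum_limit_le; have t2 := total_ge1 hS.
  have tp : 0 < total limit_survival by lra.
  rewrite /init ler_pdivlMr//; apply: (@le_trans _ _ ((stage i).2 k * 1)); last by rewrite mulr1.
  have -> : 1 / 3 * ((stage i).2 k / total (stage i).2) * total limit_survival =
      (stage i).2 k * ((total limit_survival / 3) / total (stage i).2).
    by field; rewrite lt0r_neq0//; lra.
  rewrite ler_wpM2l// ler_pdivrMr; last by lra.
  by lra.
have hw n : 1 / 3 * (1 - x) ^+ n * path_weight (stage i).2 a n <=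
    path_weight limit_survival a n.
  elim: n => [|n IH].
    by rewrite expr0 mulr1 /path_weight !big_ord0 !mulr1.
  rewrite !path_weightS exprS.
  apply: le_trans (ler_pM _ _ IH (htr (a n) (a n.+1))).
  - by rewrite le_eqVlt; apply/orP; left; apply/eqP; ring.
  - apply: mulr_ge0; last exact: path_weight_ge0.
    by apply: mulr_ge0; [lra|exact: exprn_ge0].
  - by rewrite mulr_ge0// transition_ge0.
apply: le_trans (hw L); apply: ler_wpM2r; first exact: path_weight_ge0.
have := @bernoulli_le R x L; rewrite x0 x1 => /(_ isT) hB.
have : L%:R * x <= 1 / 2.
  rewrite /x ler_pdivrMr// mulrC mulrA mulr1 ler_pdivlMr// -natrM ler_nat; lia.
by lra.
Qed.

End LimitLaw.

Lemma limn_esup_ge (R : realType) (u : nat -> \bar R) (c : \bar R) :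
  (forall i, exists2 n, (i <= n)%N & (c <= u n)%E) -> (c <= limn_esup u)%E.
Proof.
move=> h; rewrite limn_esup_lim; apply: lime_ge; first exact: is_cvg_esups.
near=> i; have [n ni le] := h i; apply: le_trans le _.
by apply: ereal_sup_ubound; exists n.
Unshelve. all: by end_near. Qed.

Lemma large_theta_error (R : realType) (x : R) (y : \bar R) :
  `|x| < 1 / 8 -> ((1 / 4)%:E <= y -> (1 / 8)%:E <= `|x%:E - y|)%E.
Proof.
move=> hx; case: y => [y||] //=; rewrite ?lee_fin => h; last by rewrite leey.
by rewrite distrC; apply: le_trans (ler_norm _); move: hx; rewrite ltr_norml => /andP[]; lra.
Qed.

Local Open Scope ereal_scope.

Theorem theorem4 (R : realType)
    (lambda : nat -> (nat -> bool) -> option nat)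
    (h : nat -> seq bool -> R)
    (lambda_stop : forall n, stopping_time (lambda n))
    (lambda_incr : strictly_increasing_times lambda)
    (lambda_rate : forall (d : measure_display) (T : measurableType d)
        (P : probability T R) (X : nat -> T -> bool),
      binary_renewal P X ->
      {ae P, forall w,
        (fun n => ext_time R (lambda n (X^~ w)) * (n%:R^-1)%R%:E) @ \oo --> 1}) :
  exists (d : measure_display) (T : measurableType d)
      (P : probability T R) (X : nat -> T -> bool),
    binary_renewal P X /\
    0 < P [set w | 0 < limn_esup (fun n => estimation_error P X lambda h n w)].
Proof.
apply: contrapT => none.
have bad0 (T : nat -> R) d (Omega : measurableType d) (P : probability Omega R)
    (M : nat -> {mfun Omega >-> nat}) : survival T -> sure_chain T P M ->
    P [set w | (0 < limn_esup (fun n =>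
      estimation_error P (fun n v => M n v != 0%N) lambda h n w))%E] = 0%E.
  move=> hT hM; apply/eqP; rewrite eq_le measure_ge0 andbT leNgt.
  apply/negP => lt; apply: none; exists d, Omega, P; eexists.
  split; first exact: (sure_chain_binary_renewal hT hM).
  exact: lt.
(* The horizon is chosen for all pairs at once, before any stage exists, because [stage] recurses on
   [block]; pairs that are not survival functions of finite range satisfy [spec] vacuously. *)
pose spec i (s : nat * (nat -> R)) L := finite_survival s.1 s.2 ->
  exists (d : measure_display) (Omega : measurableType d) (P : probability Omega R)
    (M : nat -> {mfun Omega >-> nat}), sure_chain s.2 P M /\
    ((1 / 2)%R%:E <= P [set w | low_estimate lambda h i s.1 L (fun n => M n w != 0%N)])%E.
have /choice[f hf] : forall p, exists L, spec p.1 p.2 L.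
  move=> [i s] /=.
  have [hs|ns] := pselect (finite_survival s.1 s.2); last by exists 0%N.
  have [hT TN TN0] := hs; have [d [W [mu [M hM]]]] := sure_chain_exists hT.
  have [L hL] := low_estimate_prob hT hM lambda_stop lambda_incr
    (lambda_rate _ _ _ _ (sure_chain_binary_renewal hT hM))
    (ae_error_cvg0 lambda_stop (bad0 _ _ _ _ _ hT hM)) TN TN0 i.
  by exists L => _; exists d, W, mu, M.
(* The last summand secures [2 * L i <= N i.+1] for [limit_weight_ge]. *)
pose block i s := (2 * s.1 + 4 + 2 * f (i, s))%N.
have block_gt i s : (2 * s.1 + 4 <= block i s)%N by rewrite leq_addr.
pose st i := stage block i; pose L i := f (i, st i).
have hS := limit_survival_survival block_gt.
have [d [W [mu [M hM]]]] := sure_chain_exists hS.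
pose A i := [set w | low_estimate lambda h i (st i).1 (L i) (fun n => M n w != 0%N)].
have mA i : measurable (A i).
  apply: (@measurable_ones_event _ _ M (low_estimate lambda h i (st i).1 (L i)) (L i)).
  exact: low_estimate_depends.
(* [1/12] is the [1/2] of [low_estimate_prob] times the [1/6] lost in passing to the limit law. *)
have PA i : ((1 / 12)%R%:E <= mu (A i))%E.
  have [d' [W' [mu' [M' [hM' hP']]]]] := hf (i, st i) (stage_finite block_gt i).
  have le := @path_event_le _ _ _ _ _ _ _ _ _ _ _
    (fun x => low_estimate lambda h i (st i).1 (L i) (fun n => x n != 0%N)) (L i) (1 / 6)%R
    hM' hM.
  have := le (depends_upto_ones (@low_estimate_depends _ _ h i _ _ lambda_stop)).
  rewrite divr_ge0// => /(_ isT) H; apply: (le_trans _ (H _)).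
    apply: (@le_trans _ _ ((1 / 6)%R%:E * (1 / 2)%R%:E)%E); last first.
      by apply: lee_wpmul2l => //; rewrite lee_fin.
    by rewrite -EFinM lee_fin; lra.
  move=> a; apply: limit_weight_ge => //.
  by rewrite /= /block -/(st i) -/(L i) leq_addl.
have sub : lim_sup_set A `<=` [set w | (0 < limn_esup (fun n =>
    estimation_error mu (fun n v => M n v != 0%N) lambda h n w))%E].
  move=> w hw /=; apply: (@lt_le_trans _ _ (1 / 8)%R%:E); first by rewrite lte_fin divr_gt0.
  apply: limn_esup_ge => i; have [j /= ij [n [z [jn zN ln Mz [ones hn]]]]] := hw i I.
  exists n; first exact: leq_trans jn.
  rewrite /estimation_error ln; apply: large_theta_error => //.
  have Mz0 : M z w = 0%N by move/negbFE/eqP: Mz.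
  have [_ _ Sge _] := hS.
  apply: le_trans (@theta_ge _ _ hS _ _ _ _ hM z (st j).1 (st j.+1).1 w Mz0 ones _ _).
  - by rewrite lee_fin; exact: limit_theta_ge.
  - by rewrite (limit_stage block_gt (leqnn _)); have [] := stage_finite block_gt j.
  - by have := stage_gap block_gt j; rewrite -/(st j) -/(st j.+1); lia.
have := bad0 _ _ _ _ _ hS hM; apply/eqP; rewrite gt_eqF//.
have mS : measurable (lim_sup_set A).
  by apply: bigcapT_measurable => n; apply: bigcup_measurable.
apply: (@lt_le_trans _ _ (mu (lim_sup_set A))); last first.
  apply: le_measure; rewrite ?inE//.
  exact: measurable_limsup_error lambda_stop.
apply: (@lt_le_trans _ _ (1 / 12)%R%:E); first by rewrite lte_fin divr_gt0.
(* The measure of the limsup is the limit of the measures of the tail unions, each of which contains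
   some [A n] and so has measure at least [1/12]. *)
have cv := lim_sup_set_cvg mu A mA (le_lt_trans (probability_le1 mu
  (bigcup_measurable (fun k _ => mA k))) (ltry 1)).
rewrite -(cvg_lim (@ereal_hausdorff R) cv); apply: lime_ge.
  by apply/cvg_ex; eexists; exact: cv.
near=> n; apply: le_trans (PA n) _; apply: le_measure; rewrite ?inE//.
- exact: bigcup_measurable.
- by move=> w hw; exists n => /=.
Unshelve. all: by end_near. Qed.
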